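(* Let $d\geq 1$ be an integer. If the theta series of degree $d$ of the lattices $\Gamma_8\oplus\Gamma_8$ and $\Gamma_{16}$ agree, i.e. $\Theta_{\Gamma_8\oplus\Gamma_8}^{(d)}=\Theta_{\Gamma_{16}}^{(d)}$ as functions on $\mathcal{H}_d$, then for any given flat torus $T^d$ of dimension $d$ the energy spectra (including multiplicities) of harmonic maps from $T^d$ to $T_{8,8}$ and from $T^d$ to $T_{16}$ are the same; that is, every $E\in\mathbb{R}_{\geq 0}$ has the same multiplicity in the energy spectrum of harmonic maps $T^d\to T_{8,8}$ as in the energy spectrum of harmonic maps $T^d\to T_{16}$.
   Context: Flat tori: a flat torus of dimension $m$ is a quotient $T^m=\mathbb{R}^m/\Lambda_m$ by a lattice $\Lambda_m\subset\mathbb{R}^m$ of full rank, with the Riemannian metric induced from the standard Euclidean scalar product. Energy and harmonic maps: for a smooth map $f\colon(\Sigma,h)\to(M,g)$ between Riemannian manifolds, $\Sigma$ closed and oriented, the energy is $E[f]=\tfrac12\int_\Sigma|df|^2\,\mathrm{dvol}_h$, where $|df|^2$ is the length-squared of the differential determined by $h$ and $g$. Harmonic maps are the stationary points of $E$ under variations of $f$. Energy spectrum: for flat tori $T^m,T^n$, the energy spectrum of harmonic maps is the set $\{E[f]\mid f\colon T^m\to T^n\text{ harmonic}\}\subset\mathbb{R}_{\geq0}$. The multiplicity of a value $E\in\mathbb{R}_{\ge 0}$ is the number of homotopy classes of harmonic maps $f\colon T^m\to T^n$ with $E[f]=E$ (it is $0$ if $E$ does not occur). The lattices and tori: let $L_n=\{z\in\mathbb{Z}^n\mid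 \sum_{i=1}^n z_i\text{ is even}\}$ and let $\Gamma_n\subset\mathbb{R}^n$ be the lattice generated by $L_n$ and the vector $(\tfrac12,\ldots,\tfrac12)$. Consider $\Gamma_8\oplus\Gamma_8\subset\mathbb{R}^8\oplus\mathbb{R}^8=\mathbb{R}^{16}$ and $\Gamma_{16}\subset\mathbb{R}^{16}$, with the form $Q$ given by the restriction of the standard Euclidean scalar product; both are even unimodular lattices. Set $T_{8,8}=\mathbb{R}^{16}/(\Gamma_8\oplus\Gamma_8)$ and $T_{16}=\mathbb{R}^{16}/\Gamma_{16}$, as flat tori. Theta series: for an even, positive definite, unimodular lattice $\Lambda$ with bilinear form $Q$, and $x=(x_1,\ldots,x_d)\in\Lambda^d$, put $Q(x)=(Q(x_i,x_j))_{i,j=1,\ldots,d}\in\mathbb{Z}^{d\times d}$. The theta series of degree $d$ is $\Theta_\Lambda^{(d)}(Z)=\sum_{x\in\Lambda^d}e^{\pi i\,\mathrm{Tr}(Q(x)Z)}$ for $Z$ in the Siegel upper half space $\mathcal{H}_d=\{Z=X+iY\mid X,Y\in\mathbb{R}^{d\times d}\text{ symmetric},\ Y\text{ positive definite}\}$. *)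

(* Defs.v *)
From HB Require Import structures.
From mathcomp Require Import all_boot all_order all_algebra.
From mathcomp Require Import generic_quotient ring_quotient.
From mathcomp Require Import all_classical all_reals all_analysis.
From mathcomp Require Import finmap complex.
From mathcomp.analysis.showcase Require summability.

Set Implicit Arguments.
Unset Strict Implicit.
Unset Printing Implicit Defensive.

Import Order.TTheory GRing.Theory Num.Theory.
Import numFieldNormedType.Exports.

Local Open Scope classical_set_scope.
Local Open Scope ring_scope.
Local Open Scope complex_scope.
Local Open Scope quotient_scope.

Definition zspan (V : zmodType) (S : set V) : {pred V} :=
  fun v => `[< forall H : zmodClosed V, (forall u, S u -> u \in H) -> v \in H >].

Fact zspan_zmod_closed (V : zmodType) (S : set V) : zmod_closed (zspan S).
Proof.
split=> [|u v /asboolP uS /asboolP vS]; apply/asboolP => H SH.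
  exact: rpred0.
by rewrite rpredB ?uS ?vS.
Qed.

HB.instance Definition _ (V : zmodType) (S : set V) :=
  GRing.isZmodClosed.Build V (zspan S) (zspan_zmod_closed S).

Definition dsum (R : pzRingType) m n (L : zmodClosed 'rV[R]_m)
    (M : zmodClosed 'rV[R]_n) : {pred 'rV[R]_(m + n)} :=
  [pred w | (lsubmx w \in L) && (rsubmx w \in M)].

Fact dsum_zmod_closed (R : pzRingType) m n (L : zmodClosed 'rV[R]_m)
  (M : zmodClosed 'rV[R]_n) : zmod_closed (dsum L M).
Proof.
split=> [|u v /andP[uL uM] /andP[vL vM]]; rewrite inE /=.
  by rewrite !linear0 !rpred0.
by rewrite !linearB /= !rpredB.
Qed.

HB.instance Definition _ (R : pzRingType) m n (L : zmodClosed 'rV[R]_m)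
    (M : zmodClosed 'rV[R]_n) :=
  GRing.isZmodClosed.Build 'rV[R]_(m + n) (dsum L M) (dsum_zmod_closed L M).

Definition basis_lattice (R : pzRingType) m (A : 'M[R]_m) : zmodClosed 'rV[R]_m :=
  zspan [set row i A | i in [set: 'I_m]].

Definition even_lattice (R : pzRingType) n : set 'rV[R]_n :=
  [set map_mx intr z | z in [set z : 'rV[int]_n | (2 %| \sum_i z ord0 i)%Z]].
Arguments even_lattice : clear implicits.

Definition Gamma (R : unitRingType) n : zmodClosed 'rV[R]_n :=
  zspan (even_lattice R n `|` [set const_mx 2^-1]).

Definition Gamma88 (R : unitRingType) : zmodClosed 'rV[R]_(8 + 8) :=
  dsum (Gamma R 8) (Gamma R 8).

Section Theta.
Variable R : realType.

Definition cexp (z : R[i]) : R[i] :=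
  (expR (complex.Re z))%:C * (cos (complex.Im z) +i* sin (complex.Im z)).

Definition siegel d : set 'M[R[i]]_d :=
  [set Z | exists X Y : 'M[R]_d,
    [/\ X^T = X, Y^T = Y,
        (forall v : 'rV[R]_d, v != 0 -> 0 < (v *m Y *m v^T) ord0 ord0) &
        Z = map_mx (real_complex R) X + 'i%C *: map_mx (real_complex R) Y]].

(* A d-tuple of lattice vectors is the matrix x having them as rows, so that
   the Gram matrix Q(x) is x *m x^T. *)
Definition tuples d n (L : zmodClosed 'rV[R]_n) : set 'M[R]_(d, n) :=
  [set x | forall i, row i x \in L].
Arguments tuples d {n} L.

(* summability.sum is the limit of the finite partial sums along the directed
   set of finite subsets of the index type. *)
Definition theta d n (L : zmodClosed 'rV[R]_n) (Z : 'M[R[i]]_d) : R[i] :=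
  summability.sum (fun x : set_type (tuples d L) =>
    let Q := val x *m (val x)^T in
    cexp (pi%:C * 'i%C * \tr (map_mx (real_complex R) Q *m Z)) : (R[i])^o).

End Theta.

Definition torus (R : realType) n (L : zmodClosed 'rV[R]_n) :=
  quotient_topology (Quotient.quot L).

HB.instance Definition _ (R : realType) n (L : zmodClosed 'rV[R]_n) :=
  Topological.copy (torus L) (quotient_topology (Quotient.quot L)).
HB.instance Definition _ (R : realType) n (L : zmodClosed 'rV[R]_n) :=
  Quotient.on (torus L).

Section Maps.
Variable R : realType.

Fixpoint Ck k (V W : normedModType R) (U : set V) (F : V -> W) : Prop :=
  if k is k'.+1 then
    (forall x, U x -> differentiable F x) /\
    (forall v, Ck k' U (fun x => 'D_v F x))
  else forall x, U x -> {for x, continuous F}.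

Definition smooth_on (V W : normedModType R) (U : set V) (F : V -> W) :=
  forall k, Ck k U F.

(* The charts of a flat torus are the local inverses of the projection from R^n,
   so a map into it is smooth near x when it has a smooth lift near x. *)
Definition smooth_lift (V : normedModType R) n (L : zmodClosed 'rV[R]_n)
    (f : V -> torus L) (x : V) (F : V -> 'rV[R]_n) :=
  exists U : set V, [/\ open U, U x, smooth_on U F &
    forall y, U y -> f y = \pi_(torus L) (F y)].

Definition smooth_at (V : normedModType R) n (L : zmodClosed 'rV[R]_n)
    (f : V -> torus L) (x : V) := exists F, smooth_lift f x F.

Definition homotopic (S T : topologicalType) (f g : S -> T) :=
  exists H : R -> S -> T,
    [/\ {within [set p : R * S | 0 <= p.1 <= 1], continuous (fun p => H p.1 p.2)},
        H 0 = f & H 1 = g].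

Definition homotopy_class (S T : topologicalType) (f : S -> T) : set (S -> T) :=
  [set g | homotopic f g].

(* The library has no Lebesgue measure on R^n: by Fubini, the integral of a
   continuous g over [0, 1]^n is the iterated one. *)
Fixpoint cube_integral n : ('rV[R]_n -> R) -> R :=
  if n is n'.+1 then fun g =>
    (\int[lebesgue_measure]_(t in `[0%R, 1%R])
       cube_integral (fun v : 'rV[R]_n' => g (row_mx (t%:M : 'M[R]_1) v)))%R
  else fun g => g 0.

Section Energy.
Variables (m n : nat) (A : 'M[R]_m) (L : zmodClosed 'rV[R]_n).
Local Notation T := (torus (basis_lattice A)).

Definition smooth_map (f : T -> torus L) :=
  forall x : 'rV[R]_m, smooth_at (f \o \pi_T) x.

(* |df|^2 at the image of x in T, read off from any smooth lift of f near x
   (two lifts differ by a locally constant element of L, for L discrete). *)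
Definition normsq_diff (f : T -> torus L) (x : 'rV[R]_m) : R :=
  xget 0 [set e | exists2 F, smooth_lift (f \o \pi_T) x F &
                    e = \sum_i \sum_j ('J F x i j) ^+ 2].

(* The parallelepiped spanned by the rows of A is a fundamental domain; it is
   parametrized by t |-> t *m A, with Jacobian |det A|. *)
Definition energy (f : T -> torus L) : R :=
  2^-1 * (`|\det A| * cube_integral (fun t => normsq_diff f (t *m A))).

Definition smooth_variation (eps : R) (H : R -> T -> torus L) :=
  forall (t : R) (x : 'rV[R]_m), `|t| < eps ->
    smooth_at (fun p : R * 'rV[R]_m => H p.1 (\pi_T p.2)) (t, x).

Definition harmonic_map (f : T -> torus L) :=
  smooth_map f /\
  forall (eps : R) (H : R -> T -> torus L),
    0 < eps -> smooth_variation eps H -> H 0 = f ->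
    is_derive (0 : R) (1 : R) (fun t => energy (H t)) 0.

(* The multiplicity of E is the cardinality of this set. *)
Definition harmonic_classes (E : R) : set (set (T -> torus L)) :=
  [set homotopy_class f | f in [set f | harmonic_map f /\ energy f = E]].

End Energy.
End Maps.

Arguments harmonic_classes {R m n} A L E.

(* Main.v *)
From HB Require Import structures.
Require Import Defs.
From mathcomp Require Import all_boot all_order all_algebra.
From mathcomp Require Import generic_quotient ring_quotient.
From mathcomp Require Import all_classical all_reals all_analysis.
From mathcomp Require Import finmap complex.
From mathcomp Require Import ring lra zify.
From mathcomp.analysis.showcase Require summability.

(** A map between flat tori lifts to a map of Euclidean spaces, equivariant for a
    homomorphism of lattices, i.e. for the matrix [X] of the images of the basis
    vectors, and [X] determines the homotopy class.  The lift is the sum of a linear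
    map and a periodic map, and the cross term in the energy integrates to zero; hence
    the energy is a constant depending on [X] plus the Dirichlet energy of the
    periodic part.  So linear maps are harmonic, and any harmonic map has the energy
    of the linear map in its class: the multiplicity of [E] is the number of tuples
    [X] of lattice vectors with [|det A| |A^-1 X|^2 / 2 = E].

    On the ray [Z = i t (A A^T)^-1] the theta series is a sum of exponentials
    [exp (- pi t |A^-1 X|^2)] over such tuples, and these sums determine how often
    each value of [|A^-1 X|^2] is taken.  The only property of the two lattices
    that matters is that they are contained in [(1/2) Z^16]. *)

Set Implicit Arguments.
Unset Strict Implicit.
Unset Printing Implicit Defensive.

Import Order.TTheory GRing.Theory Num.Theory.
Import numFieldNormedType.Exports.

Local Open Scope classical_set_scope.
Local Open Scope ring_scope.
Local Open Scope quotient_scope.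
Local Open Scope complex_scope.

(** * Lifting maps to a flat torus *)

(** No harmonic map equation is solved, and harmonic maps are not shown to be affine: a single
    variation, shrinking the periodic part of the lift, already fixes the energy, which is all that
    a multiplicity sees. Homotopies are merely continuous and variations are smooth only for
    [|t| < eps], so lifting is proved for locally liftable maps on star-shaped open sets, which
    covers R^m, R x R^m and the slab [|t| < eps]; smoothness of the lift is recovered afterwards.
    Discreteness of the lattice makes two lifts of one map differ by a constant, and most facts
    about [X] are instances of this.

    On the ray all terms of the theta series are positive reals, so its value is the supremum of its
    finite partial sums, and the two sides are compared through finite sums only. Finitely many
    tuples lie below any bound, so that at the least value where the counts could differ, the terms
    of this value outweigh all larger ones as t grows. Containment in (1/2) Z^16 enters twice: it
    gives discreteness, and it bounds the exponential sums by a product of geometric series. *)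

Lemma connected_locally_constant (T : topologicalType) (A : set T) (P : T -> Prop) :
    connected A -> (forall x, A x -> \forall y \near x, A y -> (P y <-> P x)) ->
  forall x y, A x -> A y -> P x -> P y.
Proof.
move=> cA lP x y Ax Ay Px.
suff AP : A `&` [set z | P z] = A by move: Ay; rewrite -AP => -[].
apply: cA; first by exists x.
- exists [set z | A z -> P z]^°; first exact: open_interior.
  apply/seteqP; split=> z [Az].
    by move=> Pz; split=> //; apply: filterS (lP z Az) => w + Aw => /(_ Aw)/iffRL; exact.
  by move=> /interior_subset/(_ Az).
- exists (~` [set z | A z -> ~ P z]^°); first exact/open_closedC/open_interior.
  apply/seteqP; split=> z [Az].
    by move=> Pz; split=> // /interior_subset /(_ Az).
  move=> nPz; split=> //; apply: contrapT => nP; apply: nPz.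
  apply: filterS (lP z Az) => w + Aw => /(_ Aw)/iffLR Pw /Pw.
  exact: nP.
Unshelve. all: by end_near. Qed.

Section Segments.
Variables (R : realType) (V : normedModType R).
Implicit Types (U : set V) (x y p v : V).

Lemma scale_lerpE x y (t : R) : x + t *: (y - x) = (1 - t) *: x + t *: y.
Proof. by rewrite scalerBr scalerBl scale1r addrA addrAC. Qed.

Lemma lerp_subE x y x' y' (t : R) :
  (1 - t) *: x + t *: y - ((1 - t) *: x' + t *: y') =
  (1 - t) *: (x - x') + t *: (y - y').
Proof. by rewrite opprD addrACA -!scalerBr. Qed.

Lemma lerp_norm_lt x y (t e : R) : 0 <= t <= 1 -> `|x| < e -> `|y| < e ->
  `|(1 - t) *: x + t *: y| < e.
Proof.
move=> /andP[t0 t1] xe ye; apply: le_lt_trans (ler_normD _ _) _.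
rewrite !normrZ (ger0_norm t0) ger0_norm ?subr_ge0//.
have [t0'|t0'] := ltP 0 t; first by nra.
have -> : t = 0 by lra.
by rewrite subr0 mul1r mul0r addr0.
Qed.

Definition cvx U := forall x y (t : R), U x -> U y -> 0 <= t <= 1 ->
  U ((1 - t) *: x + t *: y).

Definition star_shaped (p : V) U :=
  forall x (t : R), U x -> 0 <= t <= 1 -> U ((1 - t) *: p + t *: x).

Lemma star_shaped_connected p U : U p -> star_shaped p U -> connected U.
Proof.
move=> Up sU.
have -> : U = \bigcup_(x in U) [set (1 - s) *: p + s *: x | s in `[0, 1]].
  apply/seteqP; split=> [x Ux|y [x Ux] [s /= s01 <-]].
    by exists x => //; exists 1; rewrite /= ?in_itv/= ?ler01 ?lexx// subrr scale0r scale1r add0r.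
  by apply: sU => //; move: s01; rewrite in_itv.
apply: bigcup_connected.
  by exists p => x Ux; exists 0; rewrite /= ?in_itv/= ?ler01 ?lexx// scale0r addr0 subr0 scale1r.
move=> x Ux; apply: connected_continuous_connected; first exact: segment_connected.
apply: continuous_subspaceT => s; under [X in continuous_at _ X]eq_fun do rewrite -scale_lerpE.
apply: cvgD; first exact: cvg_cst.
by apply: cvgZr_tmp; exact: cvg_id.
Qed.

(** The [e]-neighbourhood of the part [u <= s] of the segment from [p] to [x]. It is open, so that
    lifts on it are continuous in the ambient sense, and convex, so that two tubes issued from [p]
    meet in a connected set. *)
Definition tube (p x : V) (s e : R) : set V :=
  [set y | exists2 u : R, 0 <= u <= s & `|y - ((1 - u) *: p + u *: x)| < e].

Lemma open_norm_lt (x : V) (e : R) : open [set y | `|y - x| < e].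
Proof.
rewrite openE => y /= ye; have e0 : 0 < e - `|y - x| by rewrite subr_gt0.
apply/nbhs_ballP; exists (e - `|y - x|) => // z; rewrite -ball_normE /= => yz.
rewrite -(subrK y z) -addrA; apply: le_lt_trans (ler_normD _ _) _.
by rewrite distrC -ltrBrDr.
Qed.

Lemma open_tube p x s e : open (tube p x s e).
Proof.
rewrite (_ : tube p x s e = \bigcup_(u in [set u : R | 0 <= u <= s])
   [set y | `|y - ((1 - u) *: p + u *: x)| < e]).
  by apply: bigcup_open => u _; exact: open_norm_lt.
by apply/seteqP; split=> y [u]; exists u.
Qed.

Lemma cvx_norm_lt (x : V) (e : R) : cvx [set y | `|y - x| < e].
Proof.
move=> y z t /= yx zx t01.
have -> : x = (1 - t) *: x + t *: x by rewrite -scalerDl subrK scale1r.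
by rewrite lerp_subE; exact: lerp_norm_lt.
Qed.

Lemma cvx_tube p v s e : cvx (tube p v s e).
Proof.
move=> x y t [a as_ xa] [b bs yb] t01.
exists ((1 - t) * a + t * b).
  case/andP: t01 => t0 t1; case/andP: as_ => a0 asl; case/andP: bs => b0 bsl.
  apply/andP; split; nra.
have -> : (1 - ((1 - t) * a + t * b)) *: p + ((1 - t) * a + t * b) *: v =
    (1 - t) *: ((1 - a) *: p + a *: v) + t *: ((1 - b) *: p + b *: v).
  rewrite !scalerDr !scalerA addrACA -!scalerDl; congr (_ *: _ + _); ring.
by rewrite lerp_subE; exact: lerp_norm_lt.
Qed.

Lemma cvxI U W : cvx U -> cvx W -> cvx (U `&` W).
Proof. by move=> cU cW x y s [Ux Wx] [Uy Wy] s01; split; [exact: cU|exact: cW]. Qed.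

Lemma cvx_connected U : cvx U -> connected U.
Proof.
move=> cU; have [->|/set0P[p Up]] := eqVneq U set0; first exact: connected0.
by apply: (@star_shaped_connected p) => // x s Ux; exact: cU.
Qed.
End Segments.

Definition discrete_lattice (R : realType) n (L : zmodClosed 'rV[R]_n) :=
  exists2 r : R, 0 < r & forall v, v \in L -> `|v| < r -> v = 0.

Lemma torus_eqE (R : realType) n (L : zmodClosed 'rV[R]_n) (u v : 'rV[R]_n) :
  \pi_(torus L) u = \pi_(torus L) v <-> u - v \in L.
Proof.
by rewrite Quotient.idealrBE; split=> [uv|/eqP//]; apply/eqP; exact: uv.
Qed.

Lemma near_eq_continuous (S T : topologicalType) (F G : S -> T) (x : S) :
  {for x, continuous F} -> (\forall y \near x, F y = G y) -> {for x, continuous G}.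
Proof.
move=> cF FG; rewrite /prop_for /continuous_at -(nbhs_singleton FG).
by apply: cvg_trans cF; apply: near_eq_cvg; apply: filterS FG => y ->.
Qed.

Section Lifts.
Variables (R : realType) (V : normedModType R) (n : nat).
Variable (L : zmodClosed 'rV[R]_n).
Hypothesis Ld : discrete_lattice L.
Implicit Types (U : set V) (f : V -> torus L) (F : V -> 'rV[R]_n).

Definition lifts_on U f F := forall y, U y ->
  {for y, continuous F} /\ f y = \pi_(torus L) (F y).

(** Where both maps lift [f], the difference [F - G] takes values in [L]. By continuity it moves by
    less than the radius [r] that isolates 0 in [L], hence not at all. *)
Lemma lifts_near_eq f F G x :
  {for x, continuous F} -> {for x, continuous G} ->
  f x = \pi_(torus L) (F x) -> f x = \pi_(torus L) (G x) ->
  \forall y \near x, f y = \pi_(torus L) (F y) -> f y = \pi_(torus L) (G y) ->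
     F y - G y = F x - G x.
Proof.
move=> cF cG fFx fGx; have [r r0 Lr] := Ld.
have cFG : {for x, continuous (F - G)} by exact: cvgB.
have /cvgrPdist_lt/(_ _ r0) := cFG.
apply: filterS => y /= FGy fFy fGy; apply/esym/subr0_eq/Lr => //.
by rewrite rpredB//; apply/torus_eqE; rewrite -?fFx -?fFy.
Qed.

Lemma lifts_on_diff U f F G x y : connected U -> open U ->
  lifts_on U f F -> lifts_on U f G -> U x -> U y -> F x - G x = F y - G y.
Proof.
move=> cU oU fF fG Ux Uy; apply/esym.
apply: (connected_locally_constant (P := fun z => F z - G z = F x - G x) cU _ Ux Uy) => //.
move=> z Uz; have [cF fFz] := fF _ Uz; have [cG fGz] := fG _ Uz.
near=> w => Uw; have -> // : F w - G w = F z - G z.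
have [_ fFw] := fF _ Uw; have [_ fGw] := fG _ Uw.
move: fFw fGw; near: w; exact: lifts_near_eq.
Unshelve. all: by end_near. Qed.

Variable f : V -> torus L.

Definition locally_lifts (D : set V) := forall x, D x ->
  exists2 e : R, 0 < e & exists F, lifts_on [set y | `|y - x| < e] f F.

(** A lift [F] on the tube up to [s1] and a local lift [G] around the point [q s] overlap in a
    convex set, where they differ by a constant [c] of [L]; gluing [F] with [G + c] reaches up to
    [s2]. As [s1] and [s2] are arbitrary near [s], this gives openness and closedness at once. *)
Lemma lifts_extend_tube (p x : V) (s : R) (w : 'rV[R]_n) :
    locally_lifts [set (1 - u) *: p + u *: x | u in `[0, 1]] -> 0 <= s <= 1 ->
  exists2 e : R, 0 < e & forall s1 s2, 0 <= s1 <= 1 -> 0 <= s2 <= 1 ->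
    `|s1 - s| < e -> `|s2 - s| < e ->
    (exists2 d, 0 < d & exists2 F, lifts_on (tube p x s1 d) f F & F p = w) ->
    (exists2 d, 0 < d & exists2 F, lifts_on (tube p x s2 d) f F & F p = w).
Proof.
move=> lf s01; set q := fun u : R => (1 - u) *: p + u *: x.
have qB u t : q u - q t = (u - t) *: (x - p).
  by rewrite /q -!scale_lerpE opprD addrACA subrr add0r -scalerBl.
have [e0 e00 [G fG]] : exists2 e : R, 0 < e & exists F, lifts_on [set y | `|y - q s| < e] f F.
  by apply: lf; exists s; rewrite //= in_itv.
have xp0 : 0 < `|x - p| + 1 by rewrite ltr_wpDl.
(* A parameter within this distance of [s] moves [q] by less than [e0 / 2]; the other half of [e0]
   is left for the radius of the new tube. The summand 1 covers [x = p]. *)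
exists (e0 / 2 / (`|x - p| + 1)); first by rewrite !divr_gt0.
have near_q u : `|u - s| < e0 / 2 / (`|x - p| + 1) -> `|q u - q s| < e0 / 2.
  rewrite qB normrZ ltr_pdivlMr// => us; apply: le_lt_trans us.
  by rewrite ler_wpM2l// lerDl.
move=> s1 s2 s101 s201 s1s s2s [d d0 [F fF Fp]].
pose c := F (q s1) - G (q s1).
pose F2 y := if y \in tube p x s1 d then F y else G y + c.
have tq u : 0 <= u <= s1 -> tube p x s1 d (q u).
  by move=> us; exists u => //; rewrite subrr normr0.
have s1t : tube p x s1 d (q s1) by apply: tq; case/andP: s101 => ->/=.
have s1b : `|q s1 - q s| < e0 by apply: lt_trans (near_q _ s1s) _; lra.
have F2E y : `|y - q s| < e0 -> F2 y = G y + c.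
  move=> ye; rewrite /F2; case: ifPn => // /set_mem ty.
  apply: subr0_eq; rewrite opprD addrA /c addrC; apply/eqP; rewrite addrC subr_eq0; apply/eqP.
  apply: (@lifts_on_diff (tube p x s1 d `&` [set y | `|y - q s| < e0]) f) => //.
  - by apply: cvx_connected; apply: cvxI; [exact: cvx_tube|exact: cvx_norm_lt].
  - by apply: openI; [exact: open_tube|exact: open_norm_lt].
  - by move=> z [/fF].
  - by move=> z [_ /fG].
have cL : c \in L.
  by apply/torus_eqE; have [_ <-] := fF _ s1t; have [_ <-] := fG _ s1b.
have F2lift y : tube p x s1 d y \/ `|y - q s| < e0 ->
    {for y, continuous F2} /\ f y = \pi_(torus L) (F2 y).
  move=> [ty|by_].
    have [cF fFy] := fF _ ty; split; last by rewrite /F2 ifT//; exact/mem_set.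
    apply: near_eq_continuous cF _.
    have := open_nbhs_nbhs (conj (@open_tube _ _ p x s1 d) ty).
    by apply: filterS => z tz; rewrite /F2 ifT//; exact/mem_set.
  have [cG fGy] := fG _ by_; split; last first.
    rewrite F2E// fGy; apply/torus_eqE.
    by rewrite opprD addrA subrr add0r rpredN.
  apply: (@near_eq_continuous _ _ (fun y => G y + c)).
    by apply: cvgD => //; exact: cvg_cst.
  have := open_nbhs_nbhs (conj (@open_norm_lt _ _ (q s) e0) by_).
  by apply: filterS => z /F2E ->.
(* Points of the new tube over [u <= s1] lie in the old tube because of [d]; those over [u > s1] are
   within [e0 / 2] of [q u], hence within [e0] of [q s]. *)
exists (Num.min d (e0 / 2)); first by rewrite lt_min d0 divr_gt0.
exists F2; last first.
  rewrite /F2 ifT//; apply/mem_set; exists 0; first by rewrite lexx; case/andP: s101.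
  by rewrite subr0 scale1r scale0r addr0 subrr normr0.
move=> y [u /andP[u0 us2]]; rewrite lt_min => /andP[yd ye]; apply: F2lift.
have [us1|s1u] := leP u s1; first by left; exists u; rewrite // u0.
right; rewrite -(subrK (q u) y) -addrA (splitr e0).
apply: le_lt_trans (ler_normD _ _) _; apply: ltrD => //; apply: near_q.
have [us|us] := leP s u.
  rewrite ger0_norm ?subr_ge0//; apply: le_lt_trans s2s.
  rewrite ger0_norm; lra.
rewrite ltr0_norm ?subr_lt0//; apply: le_lt_trans s1s.
rewrite ltr0_norm; lra.
Qed.

(* The parameters up to which the segment from [p] to [x] has a lift on some tube
   form a clopen subset of [0, 1].  The lifts obtained for various [x] agree,
   since tubes around segments issued from [p] meet in a connected set. *)
Theorem global_lift (D : set V) (p : V) (w : 'rV[R]_n) :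
    open D -> D p -> star_shaped p D -> locally_lifts D -> f p = \pi_(torus L) w ->
  exists2 F, lifts_on D f F & F p = w.
Proof.
move=> oD Dp sD lf fp.
have tl x : D x -> exists2 d, 0 < d & exists2 F, lifts_on (tube p x 1 d) f F & F p = w.
  move=> Dx.
  have lfx : locally_lifts [set (1 - u) *: p + u *: x | u in `[0, 1]].
    by move=> _ [u /= u01 <-]; apply: lf; apply: sD => //; move: u01; rewrite in_itv.
  pose P s := exists2 d, 0 < d & exists2 F, lifts_on (tube p x s d) f F & F p = w.
  have := @connected_locally_constant R `[0, 1]%classic P (@segment_connected R 0 1).
  move/(_ _ 0 1); apply.
  - move=> s; rewrite /= in_itv/= => s01.
    have [e e0 es] := lifts_extend_tube w lfx s01.
    have ss : `|s - s| < e by rewrite subrr normr0.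
    near=> t; rewrite in_itv/= => t01.
    have ts : `|t - s| < e.
      by near: t; exact: open_nbhs_nbhs (conj (@open_norm_lt R R^o s e) ss).
    by split; exact: es.
  - by rewrite /= in_itv/= lexx ler01.
  - by rewrite /= in_itv/= lexx ler01.
  have [e e0 [G fG]] := lf _ Dp.
  exists e => //; exists (fun y => G y + (w - G p)); last by rewrite subrKC.
  move=> y [u u0]; have -> : u = 0 by lra.
  rewrite subr0 scale1r scale0r addr0 => /fG[cG fGy]; split.
    by apply: cvgD => //; exact: cvg_cst.
  rewrite fGy; apply/torus_eqE; rewrite opprD addrA subrr add0r.
  rewrite opprB; apply/torus_eqE; rewrite -fp; apply/esym.
  by have [] := fG p; rewrite //= subrr normr0.
have {}tl x : {d : R & {F | D x -> [/\ 0 < d, lifts_on (tube p x 1 d) f F & F p = w]}}.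
  have [Dx|nDx] := pselect (D x); last by exists 0, (fun=> 0).
  have /cid2[d d0 /cid2[F fF Fp]] := tl _ Dx.
  by exists d, F.
pose dd x := projT1 (tl x); pose FF x := sval (projT2 (tl x)).
have FP x : D x -> [/\ 0 < dd x, lifts_on (tube p x 1 (dd x)) f (FF x) & FF x p = w].
  exact: (svalP (projT2 (tl x))).
have tp x : D x -> tube p x 1 (dd x) p.
  move=> Dx; have [d0 _ _] := FP _ Dx.
  by exists 0; rewrite ?lexx ?ler01// subr0 scale1r scale0r addr0 subrr normr0.
have tx x : D x -> tube p x 1 (dd x) x.
  move=> Dx; have [d0 _ _] := FP _ Dx.
  by exists 1; rewrite ?lexx ?ler01// subrr scale1r scale0r add0r subrr normr0.
(* Each point takes the value of the lift on its own tube; [FE] turns this into one fixed lift near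
   each point, whence continuity. *)
pose F x := FF x x.
have FE x y : D x -> D y -> tube p x 1 (dd x) y -> F y = FF x y.
  move=> Dx Dy txy; have [_ fx Fxp] := FP x Dx; have [_ fy Fyp] := FP y Dy.
  apply/eqP; rewrite -subr_eq0; apply/eqP.
  have := @lifts_on_diff (tube p x 1 (dd x) `&` tube p y 1 (dd y)) f (FF y) (FF x) y p.
  rewrite Fxp Fyp subrr; apply.
  - by apply: cvx_connected; apply: cvxI; exact: cvx_tube.
  - by apply: openI; exact: open_tube.
  - by move=> z [_ ?]; exact: fy.
  - by move=> z [? _]; exact: fx.
  - by split=> //; exact: tx.
  - by split=> //; exact: tp.
exists F; last by rewrite /F; have [] := FP p Dp.
move=> x Dx; have [_ fx _] := FP x Dx; have [cF fFx] := fx x (tx x Dx).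
split; last exact: fFx.
apply: near_eq_continuous cF _.
 have : nbhs x (D `&` tube p x 1 (dd x)).
  by apply: open_nbhs_nbhs; split; [apply: openI => //; exact: open_tube|split=> //; exact: tx].
by apply: filterS => y [Dy ty]; rewrite (FE x y).
Unshelve. all: by end_near. Qed.
End Lifts.

(** The saturation of [U] is the union of its translates by lattice vectors. *)
Lemma open_pi (R : realType) n (L : zmodClosed 'rV[R]_n) (U : set 'rV[R]_n) :
  open U -> open (\pi_(torus L) @` U).
Proof.
move=> oU; suff : open (\pi_(torus L) @^-1` (\pi_(torus L) @` U)) by [].
have -> : \pi_(torus L) @^-1` (\pi_(torus L) @` U) =
    \bigcup_(l in [set l | l \in L]) ((fun v => v - l) @^-1` U).
  apply/seteqP; split=> [v /= [u Uu /torus_eqE uvL]|v /= [l /= lL Uvl]].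
    exists (v - u); first by rewrite /= -opprB rpredN.
    by rewrite /= opprB addrCA subrr addr0.
  exists (v - l) => //; apply/torus_eqE.
  by rewrite addrAC subrr add0r rpredN.
apply: bigcup_open => l _; apply: open_comp => // v _.
apply: continuousB; last exact: cst_continuous.
by move=> ?.
Qed.

(** Fix a representative [w] of [f x]. For [y] near [x], [f y] has exactly one representative within
    [r / 2] of [w], because two of them differ by a lattice vector shorter than [r]. This
    representative is [F y], and it is continuous in [y] since the projection is open. *)
Lemma continuous_locally_lifts (R : realType) (V : normedModType R) n
    (L : zmodClosed 'rV[R]_n) (f : V -> torus L) :
  discrete_lattice L -> continuous f -> locally_lifts f [set: V].
Proof.
move=> [r r0 Lr] cf x _; pose w := repr (f x).
pose W := [set v : 'rV[R]_n | `|v - w| < r / 2].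
have oW : open W by exact: open_norm_lt.
have near_f y (O : set 'rV[R]_n) v : open O -> O v -> \pi_(torus L) v = f y ->
    \forall z \near y, exists2 v, O v & \pi_(torus L) v = f z.
  move=> oO Ov vy; have := cf y (\pi_(torus L) @` O); apply.
  by apply: open_nbhs_nbhs; split; [exact: open_pi|exists v].
have Ww : W w by rewrite /W /= subrr normr0 divr_gt0.
have /near_f/(_ Ww)/(_ _) : open W by [].
move=> /(_ x); rewrite reprK => /(_ erefl) /nbhs_ballP[e /= e0 eW].
pose F y := xget w [set v | W v /\ \pi_(torus L) v = f y].
have FP y : `|y - x| < e -> W (F y) /\ \pi_(torus L) (F y) = f y.
  move=> ye; have [|v Wv vy] := eW y; first by rewrite -ball_normE /= distrC.
  by rewrite /F; case: xgetP => [u _ //|/(_ v)]; case.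
exists e => //; exists F => y yx; have [WFy Fy] := FP y yx.
split=> //; apply/cvgrPdist_lt => d d0.
pose O := W `&` [set v | `|v - F y| < d].
have oO : open O by apply: openI => //; exact: open_norm_lt.
have Oy : O (F y) by split=> //=; rewrite subrr normr0.
have := open_nbhs_nbhs (conj (@open_norm_lt _ _ x e) yx).
apply: filterS2 (near_f _ _ _ oO Oy Fy) => z [v [Wv vd] vz] /FP[WFz Fz].
rewrite distrC; suff -> : F z = v by [].
apply: subr0_eq; apply: Lr; first by apply/torus_eqE; rewrite Fz.
rewrite -(subrK w (F z)) -addrA (splitr r); apply: le_lt_trans (ler_normD _ _) _.
by apply: ltrD => //; rewrite distrC.
Qed.

(** * Homotopy classes and monodromy *)

(** [zspan] quantifies over packaged subgroups; this packages a subgroup given by a proposition, so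
    that [zspan_ind] applies to arbitrary predicates. *)
Definition zmod_pred (V : zmodType) (P : set V)
  (PB : P 0 /\ forall u v, P u -> P v -> P (u - v)) : {pred V} := fun v => `[< P v >].

Fact zmod_pred_closed (V : zmodType) (P : set V)
  (PB : P 0 /\ forall u v, P u -> P v -> P (u - v)) : zmod_closed (zmod_pred PB).
Proof.
case: (PB) => P0 PB'; split=> [|u v /asboolP uP /asboolP vP]; apply/asboolP => //.
exact: PB'.
Qed.

HB.instance Definition _ (V : zmodType) (P : set V)
    (PB : P 0 /\ forall u v, P u -> P v -> P (u - v)) :=
  GRing.isZmodClosed.Build V (zmod_pred PB) (zmod_pred_closed PB).

Lemma zspan_ind (V : zmodType) (S P : set V) :
    P 0 -> (forall u v, P u -> P v -> P (u - v)) -> S `<=` P ->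
  forall v, v \in zspan S -> P v.
Proof.
move=> P0 PB SP v /asboolP/(_ (zmod_pred (conj P0 PB))) vP.
by apply/asboolP/vP => u /SP Pu; exact/asboolP.
Qed.

Lemma zspan_mem (V : zmodType) (S : set V) u : S u -> u \in zspan S.
Proof. by move=> Su; apply/asboolP => H; exact. Qed.

Lemma continuous_shift (R : realType) (V W : normedModType R) (F : V -> W) (v : V) :
  continuous F -> continuous (fun x => F (x + v)).
Proof.
move=> cF x; apply: (@continuous_comp _ _ _ (fun x => x + v) F); last exact: cF.
by apply: continuousD; [move=> ?|exact: cst_continuous].
Qed.

Lemma continuous_lerp (R : realType) (V W : normedModType R) (F G : V -> W) :
  continuous F -> continuous G ->
  continuous (fun p : R * V => (1 - p.1) *: F p.2 + p.1 *: G p.2).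
Proof.
move=> cF cG p; apply: cvgD.
  apply: cvgZ; first by apply: cvgB; [exact: cvg_cst|exact: cvg_fst].
  by apply: (@cvg_comp _ _ _ snd F _ (nbhs p.2)); [exact: cvg_snd|exact: cF].
apply: cvgZ; first exact: cvg_fst.
by apply: (@cvg_comp _ _ _ snd G _ (nbhs p.2)); [exact: cvg_snd|exact: cG].
Qed.

Lemma continuous_slice (R : realType) (V W : normedModType R) (Phi : R * V -> W) (t : R) :
  continuous Phi -> continuous (fun x => Phi (t, x)).
Proof.
move=> cPhi x; apply: (@cvg_comp _ _ _ (fun x => (t, x)) Phi _ (nbhs (t, x))).
  exact: (@cvg_pair V R V (nbhs x) (nbhs t) (nbhs x) _ _ _ (fun=> t) id (cvg_cst t) cvg_id).
exact: cPhi.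
Qed.

Section Monodromy.
Variables (R : realType) (m n : nat) (A : 'M[R]_m) (L : zmodClosed 'rV[R]_n).
Hypothesis Ld : discrete_lattice L.
Local Notation T := (torus (basis_lattice A)).
Implicit Types (f g : T -> torus L) (F G : 'rV[R]_m -> 'rV[R]_n) (X Y : 'M[R]_(m, n)).

Definition equivariant F X := forall i x, F (x + row i A) = F x + row i X.

Definition is_lift f F := forall x, f (\pi_T x) = \pi_(torus L) (F x).

(* The rows of [X] are the images of the basis loops under the map induced by [f]
   on fundamental groups. *)
Definition monodromy f X :=
  exists2 F, continuous F & is_lift f F /\ equivariant F X.

Lemma pi_row x i : \pi_T (x + row i A) = \pi_T x.
Proof.
apply/torus_eqE; rewrite addrAC subrr add0r; apply: zspan_mem.
by exists i.
Qed.

Lemma lift_diff_const (V : normedModType R) (h : V -> torus L) (F G : V -> 'rV[R]_n) :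
    continuous F -> continuous G -> (forall x, h x = \pi_(torus L) (F x)) ->
    (forall x, h x = \pi_(torus L) (G x)) ->
  forall x y, F x - G x = F y - G y.
Proof.
move=> cF cG hF hG x y; apply: (@lifts_on_diff _ _ _ _ Ld setT h) => //.
- exact: cvx_connected.
- exact: openT.
- by move=> z _; split; [exact: cF|exact: hF].
- by move=> z _; split; [exact: cG|exact: hG].
Qed.

(** Translating a lift by a basis vector gives another lift of the same map, so the increment is
    constant and can be read off at 0. *)
Lemma lift_equivariant f F : continuous F -> is_lift f F -> exists X, equivariant F X.
Proof.
move=> cF fF; exists (\matrix_i (F (row i A) - F 0)) => i x.
rewrite rowK; apply/eqP; rewrite [eqbRHS]addrC -subr_eq; apply/eqP.
rewrite -[X in _ = F X - F 0]add0r.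
apply: (@lift_diff_const _ (f \o \pi_T) (fun x => F (x + row i A)) F).
- exact: continuous_shift.
- exact: cF.
- by move=> y /=; rewrite -fF pi_row.
- exact: fF.
Qed.

Lemma monodromy_mem f X i : monodromy f X -> row i X \in L.
Proof.
move=> [F cF [fF FX]]; have -> : row i X = F (0 + row i A) - F 0.
  by rewrite FX addrAC subrr add0r.
by apply/torus_eqE; rewrite -!fF pi_row.
Qed.

Lemma monodromy_inj f X Y : monodromy f X -> monodromy f Y -> X = Y.
Proof.
move=> [F cF [fF FX]] [G cG [fG GY]]; apply/row_matrixP => i.
have := lift_diff_const cF cG fF fG (0 + row i A) 0.
rewrite FX GY opprD addrACA -[RHS]addr0 => /addrI/eqP.
by rewrite subr_eq0 => /eqP.
Qed.

(** The translations that change [F] by elements of [L] at every point form a subgroup, so testing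
    the basis vectors suffices. *)
Lemma equivariant_pi F : (forall i x, F (x + row i A) - F x \in L) ->
  forall x y, \pi_T x = \pi_T y -> \pi_(torus L) (F x) = \pi_(torus L) (F y).
Proof.
move=> FL x y /torus_eqE xy; apply/torus_eqE.
have : forall z, F (z + (x - y)) - F z \in L.
  move: (x - y) xy.
  apply: (@zspan_ind _ _ [set l | forall z, F (z + l) - F z \in L]).
  - by move=> z; rewrite addr0 subrr rpred0.
  - move=> u v Hu Hv z; have := Hv (z + (u - v)); have := Hu z.
    rewrite -addrA subrK => Fu Fv; have := rpredB Fu Fv.
    by rewrite opprB (addrC (_ - _) (_ - _)) addrA subrK.
  - by move=> _ [i _ <-] z; exact: FL.
by move/(_ y); rewrite (addrC y) subrK.
Qed.

(** Chosen representatives make this total in [F]; it is the induced map under the condition of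
    [descendE]. *)
Definition descend F (y : T) : torus L := \pi_(torus L) (F (repr y)).

Lemma descendE F : (forall i x, F (x + row i A) - F x \in L) -> is_lift (descend F) F.
Proof. by move=> FL x; apply: equivariant_pi => //; rewrite reprK. Qed.

Lemma equivariantB_mem F X : equivariant F X -> (forall i, row i X \in L) ->
  forall i x, F (x + row i A) - F x \in L.
Proof. by move=> FX XL i x; rewrite FX addrAC subrr add0r. Qed.

Lemma is_lift_inj f g F : is_lift f F -> is_lift g F -> f = g.
Proof. by move=> fF gF; apply/funext => y; rewrite -[y]reprK fF gF. Qed.

(** The segment homotopy between two lifts keeps the increments, since [(1 - t) X + t X = X], and
    therefore descends at every time. *)
Lemma monodromy_homotopic f g X : monodromy f X -> monodromy g X -> homotopic R f g.
Proof.
move=> fX gX; have XL i := monodromy_mem i fX.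
case: fX gX => F cF [fF FX] [G cG [gG GX]].
pose K t x := (1 - t) *: F x + t *: G x.
have KX t : equivariant (K t) X.
  move=> i x; rewrite /K FX GX !scalerDr addrACA -scalerDl subrK scale1r//.
have KL t := descendE (equivariantB_mem (KX t) XL).
exists (fun t => descend (K t)); split; last 2 first.
- by apply: (@is_lift_inj _ _ F) => // x; rewrite KL /K subr0 scale1r scale0r addr0.
- by apply: (@is_lift_inj _ _ G) => // x; rewrite KL /K subrr scale1r scale0r add0r.
apply: continuous_subspaceT => -[t y] O /=; rewrite -[y]reprK KL => O_nbhs.
have cK : continuous (fun p : R * 'rV[R]_m => K p.1 p.2).
  exact: continuous_lerp.
have := continuous_comp (cK (t, repr y)) (@pi_continuous _ (Quotient.quot L) _).
move/(_ _ O_nbhs) => -[[U1 U2] [U1t U2y] UO].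
(* Continuity is known upstairs; the open projection sends a neighbourhood of [repr y] to a
   neighbourhood of [y]. *)
move: U2y; rewrite nbhsE => -[W [oW Wy] WU2].
exists (U1, \pi_T @` W) => /=.
  split=> //; apply: open_nbhs_nbhs; split; first exact: open_pi.
  by exists (repr y).
move=> [s z] /= [U1s [x Wx <-]]; rewrite KL.
by apply: (UO (s, x)); split=> //; exact: WU2.
Qed.

(* The homotopy is clamped to [0, 1] so that it lifts on the whole of R x R^m. *)
Lemma homotopic_monodromy f g X : monodromy f X -> homotopic R f g -> monodromy g X.
Proof.
move=> [F cF [fF FX]] [H [cH H0 H1]].
pose cl : R -> R := cst 0 \max (id \min cst 1).
have cl01 t : 0 <= cl t <= 1 by rewrite le_max lexx /= ge_max ler01 ge_min lexx orbT.
pose K (p : R * 'rV[R]_m) := H (cl p.1) (\pi_T p.2).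
have ccl : continuous cl.
  apply: max_fun_continuous; first exact: cst_continuous.
  by apply: min_fun_continuous; [move=> ?|exact: cst_continuous].
have cK : continuous K.
  move=> p; move/subspace_continuousP : cH => /(_ (cl p.1, \pi_T p.2) (cl01 _)).
  apply: cvg_trans => O /= O_nbhs.
  have := O_nbhs.
  rewrite /within /= => -[[U1 U2] /= [U1t U2y] UO].
  have c1 : \forall q \near p, U1 (cl q.1).
    suff c : cl q.1 @[q --> p] --> cl p.1 by exact: (c _ U1t).
    by apply: (@cvg_comp _ _ _ fst cl _ (nbhs p.1)); [exact: cvg_fst|exact: ccl].
  have c2 : \forall q \near p, U2 (\pi_T q.2).
    suff c : \pi_T q.2 @[q --> p] --> \pi_T p.2 by exact: (c _ U2y).
    apply: (@cvg_comp _ _ _ snd \pi_T _ (nbhs p.2)); first exact: cvg_snd.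
    exact: pi_continuous.
  apply: filterS2 c1 c2 => q q1 q2.
  by apply: (UO (cl q.1, \pi_T q.2)) => //; exact: cl01.
have K0 : K (0, 0) = \pi_(torus L) (F 0).
  by rewrite /K /cl /= minEle ler01 maxxx H0 fF.
have [Phi KPhi Phi0] : exists2 Phi, lifts_on setT K Phi & Phi (0, 0) = F 0.
  apply: global_lift => //; first exact: openT.
  exact: continuous_locally_lifts.
have cPhi : continuous Phi by move=> p; have [] := KPhi p.
have {}KPhi p : K p = \pi_(torus L) (Phi p) by have [] := KPhi p.
have cPhit t : continuous (fun x => Phi (t, x)).
  exact: continuous_slice.
have PhiF x : Phi (0, x) = F x.
  apply: subr0_eq.
  rewrite (@lift_diff_const _ (f \o \pi_T) (fun x => Phi (0, x)) F _ _ _ _ x 0) ?Phi0 ?subrr//.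
  by move=> y /=; rewrite -KPhi /K /cl /= minEle ler01 maxxx H0.
exists (fun x => Phi (1, x)) => //; split.
  by move=> x; rewrite -KPhi /K /cl /= minxx maxEle ler01 H1.
move=> i x; apply/eqP; rewrite [eqbRHS]addrC -subr_eq; apply/eqP.
have -> : row i X = Phi (0, 0 + row i A) - Phi (0, 0) by rewrite !PhiF FX addrAC subrr add0r.
(* The translate of [Phi] by [(0, row i A)] lifts the same map [K], so the increment is constant in
   time and space and can be carried from time 1 to time 0. *)
have eqv : forall p q : R * 'rV[R]_m,
    Phi (p + (0, row i A)) - Phi p = Phi (q + (0, row i A)) - Phi q.
  apply: (@lift_diff_const _ K).
  - exact: continuous_shift.
  - exact: cPhi.
  - by move=> p; rewrite -KPhi /K /= addr0 pi_row.
  - exact: KPhi.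
have := eqv (1, x) (0, 0).
by rewrite /GRing.add /= /add_pair /= !addr0.
Qed.

Lemma homotopy_class_monodromy f X : monodromy f X ->
  homotopy_class R f = [set g | monodromy g X].
Proof.
move=> fX; apply/seteqP; split=> g /=; first exact: homotopic_monodromy.
exact: monodromy_homotopic.
Qed.
End Monodromy.

(** * Iterated integrals over the unit cube *)

Section MatrixNorm.
Variables (R : realType) (m n : nat).
Implicit Types M : 'M[R]_(m, n).

Lemma normr_entry M i j : `|M i j| <= `|M|.
Proof. by rewrite [leRHS]mx_normrE; exact: (le_bigmax _ _ (i, j)). Qed.

Lemma normr_le_entries M (e : R) : 0 <= e -> (forall i j, `|M i j| <= e) -> `|M| <= e.
Proof. by move=> e0 Me; rewrite [leLHS]mx_normrE; apply: bigmax_le => // -[]. Qed.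

Lemma continuous_mx (T : topologicalType) (F : T -> 'M[R]_(m, n)) (x : T) :
  (forall i j, {for x, continuous (fun t => F t i j)}) -> {for x, continuous F}.
Proof.
move=> cF; apply/cvgrPdist_le => e e0; near=> y.
apply: normr_le_entries; first exact: ltW.
move=> i j; rewrite !mxE.
suff: forall ij : 'I_m * 'I_n, `|F x ij.1 ij.2 - F y ij.1 ij.2| <= e by move/(_ (i, j)).
near: y; apply: filter_forall => -[i' j'] /=.
exact: ((cvgrPdist_le _ _).1 (cF i' j')).
Unshelve. all: by end_near. Qed.
End MatrixNorm.

(** Compactness in its near-covering form makes pointwise continuity uniform over [K]. Both
    [g (t, w)] and [g (s, w)] are compared with [g (s, v)], which accounts for [e / 2]. *)
Lemma near_uniform_compact (R : realType) (S T : topologicalType) (g : S * T -> R)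
    (K : set T) (s : S) (e : R) : compact K -> 0 < e ->
    (forall v, K v -> {for (s, v), continuous g}) ->
  \forall t \near s, forall v, K v -> `|g (t, v) - g (s, v)| < e.
Proof.
move=> /compact_near_coveringP/near_covering_withinP cK e0 cg.
apply: (cK _ _ (fun t v => `|g (t, v) - g (s, v)| < e)) => v Kv.
have e20 : 0 < e / 2 by rewrite divr_gt0.
have /cvgrPdist_lt/(_ _ e20)[[U1 U2] /= [U1s U2v] Ug] := cg v Kv.
exists (U2, U1) => //= -[w t] /= [U2w U1t] _.
have gt := Ug (t, w) (conj U1t U2w).
have gs := Ug (s, w) (conj (nbhs_singleton U1s) U2w).
rewrite /= in gt gs.
rewrite (splitr e) -(subrK (g (s, v)) (g (t, w))) -addrA.
by apply: le_lt_trans (ler_normD _ _) _; rewrite ltrD // distrC.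
Qed.

Section UnitInterval.
Variable R : realType.
Implicit Types g h : R -> R.
Local Notation mu := (@lebesgue_measure R).
Local Notation I01 := (`[0%R, 1%R]%classic : set R).

Lemma continuous_integrable01 g : continuous g -> mu.-integrable I01 (EFin \o g).
Proof.
move=> cg; apply: continuous_compact_integrable; first exact: segment_compact.
exact: continuous_subspaceT.
Qed.

Lemma Rintegral01_cst (c : R) : (\int[mu]_(t in I01) c)%R = c.
Proof.
rewrite Rintegral_cst; last exact: measurable_itv.
have mu1 : mu I01 = 1%E by rewrite lebesgue_measure_itv /= lte_fin ltr01 /= oppr0 adde0.
by transitivity (c * fine (1%E : \bar R)); [congr (c * fine _)|rewrite /= mulr1].
Qed.

Lemma Rintegral01_linear (a : R) g h : continuous g -> continuous h ->
  (\int[mu]_(t in I01) (a * g t + h t))%R =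
  a * (\int[mu]_(t in I01) g t)%R + (\int[mu]_(t in I01) h t)%R.
Proof.
move=> cg ch; rewrite RintegralD//; last 2 first.
- apply: continuous_integrable01 => t.
  by apply: cvgM; [exact: cvg_cst|exact: cg].
- exact: continuous_integrable01.
by rewrite RintegralZl//; exact: continuous_integrable01.
Qed.

Lemma Rintegral01_norm_le g (M : R) : continuous g ->
    (forall t, 0 <= t <= 1 -> `|g t| <= M) ->
  `|(\int[mu]_(t in I01) g t)%R| <= M.
Proof.
move=> cg gM; rewrite -[leRHS]Rintegral01_cst.
have ig := continuous_integrable01 cg.
apply: le_trans (le_normr_Rintegral _ _) _ => //.
apply: le_Rintegral => //.
  apply: (@continuous_integrable01 (Num.norm \o g)) => t.
  by apply: continuous_comp; [exact: cg|exact: norm_continuous].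
by apply: (@continuous_integrable01 (cst M)); exact: cst_continuous.
Qed.

Lemma Rintegral01_deriv g h : continuous h ->
    (forall t, is_derive t (1 : R) g (h t)) ->
  (\int[mu]_(t in I01) h t)%R = g 1 - g 0.
Proof.
move=> ch gh; rewrite /Rintegral (@continuous_FTC2 R h g 0 1)//.
- exact: continuous_subspaceT.
- have cg t : {for t, continuous g}.
    by apply: differentiable_continuous; apply/derivable1_diffP; have [] := gh t.
  split; first by move=> t _; have [] := gh t.
  + by apply: cvg_at_right_filter; exact: cg.
  + by apply: cvg_at_left_filter; exact: cg.
- by move=> t _; rewrite derive1E; have [] := gh t.
Qed.
End UnitInterval.

Lemma continuous_bigsum (R : realType) (T : topologicalType) (W : normedModType R)
    (I : Type) (r : seq I) (g : I -> T -> W) :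
  (forall i, continuous (g i)) -> continuous (fun v => \sum_(i <- r) g i v).
Proof.
move=> cg; elim: r => [|j r IH].
  have -> : (fun v => \sum_(i <- [::]) g i v) = cst 0.
    by apply/funext => w; rewrite big_nil.
  exact: cst_continuous.
have -> : (fun v => \sum_(i <- j :: r) g i v) = (fun v => g j v + \sum_(i <- r) g i v).
  by apply/funext => w; rewrite big_cons.
by move=> v; apply: continuousD; [exact: cg|exact: IH].
Qed.

Section CubeIntegral.
Variable R : realType.

Definition cube n : set 'rV[R]_n := [set v | forall i, `[0, 1]%classic (v ord0 i)].

Lemma compact_cube n : compact (@cube n).
Proof. by apply: (@rV_compact R n (fun=> `[0, 1]%classic)) => i; exact: segment_compact. Qed.

Definition consv n (t : R) (v : 'rV[R]_n) : 'rV[R]_n.+1 := row_mx (t%:M : 'M[R]_1) v.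

Lemma consv0 n t (v : 'rV[R]_n) : consv t v ord0 ord0 = t.
Proof.
have -> : ord0 = lshift n (ord0 : 'I_1) by exact: val_inj.
transitivity ((t%:M : 'M[R]_1) ord0 ord0); last by rewrite mxE eqxx mulr1n.
exact: row_mxEl.
Qed.

Lemma consvS n t (v : 'rV[R]_n) i : consv t v ord0 (lift ord0 i) = v ord0 i.
Proof. have -> : lift ord0 i = rshift 1 i by exact: val_inj.
exact: row_mxEr. Qed.

Lemma continuous_consv n : continuous (fun p : R * 'rV[R]_n => consv p.1 p.2).
Proof.
move=> p; apply: continuous_mx => i j; rewrite ord1.
case: (unliftP ord0 j) => [k|] ->.
  rewrite (_ : (fun t : R * 'rV[R]_n => _) = (fun v : 'rV[R]_n => v ord0 k) \o snd).
    by apply: continuous_comp; [exact: cvg_snd|exact: coord_continuous].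
  by apply/funext => q /=; rewrite consvS.
rewrite (_ : (fun t : R * 'rV[R]_n => _) = fst); first exact: cvg_fst.
by apply/funext => q /=; rewrite consv0.
Qed.

Lemma cube_consv n t (v : 'rV[R]_n) : `[0, 1]%classic t -> cube v -> cube (consv t v).
Proof.
by move=> t01 v01 i; case: (unliftP ord0 i) => [k|] ->; rewrite ?consvS ?consv0.
Qed.

Lemma continuous_slicev n (g : 'rV[R]_n.+1 -> R) t :
  continuous g -> continuous (fun v => g (consv t v)).
Proof.
move=> cg; apply: (@continuous_slice R 'rV[R]_n R^o (fun p => g (consv p.1 p.2))) => p.
by apply: continuous_comp; [exact: continuous_consv|exact: cg].
Qed.

Lemma cube_integralS n (g : 'rV[R]_n.+1 -> R) :
  cube_integral g = (\int[lebesgue_measure]_(t in `[0%R, 1%R])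
    cube_integral (fun v : 'rV[R]_n => g (consv t v)))%R.
Proof. by []. Qed.

(** Linearity and the sup bound are stated as predicates of the dimension because they are proved
    together: in dimension [n.+1] both need the integral over slices to be continuous, and this
    continuity comes from both properties in dimension [n]. *)
Definition cube_linear n := forall (a : R) (g h : 'rV[R]_n -> R),
  continuous g -> continuous h ->
  cube_integral (fun v => a * g v + h v) = a * cube_integral g + cube_integral h.

Definition cube_bound n := forall (g : 'rV[R]_n -> R) (M : R), continuous g ->
  (forall v, cube v -> `|g v| <= M) -> `|cube_integral g| <= M.

Lemma cube_integralB_of n : cube_linear n -> forall g h : 'rV[R]_n -> R,
  continuous g -> continuous h ->
  cube_integral (fun v => g v - h v) = cube_integral g - cube_integral h.
Proof.
move=> lin g h cg ch.
rewrite (_ : (fun v => g v - h v) = (fun v => -1 * h v + g v)).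
  by rewrite lin// mulN1r addrC.
by apply/funext => v; rewrite mulN1r addrC.
Qed.

Lemma cube_slice_continuous_of n : cube_linear n -> cube_bound n ->
  forall g : 'rV[R]_n.+1 -> R, continuous g ->
  continuous (fun t => cube_integral (fun v : 'rV[R]_n => g (consv t v))).
Proof.
move=> lin bnd g cg t; apply/cvgrPdist_le => e e0.
have := @near_uniform_compact R _ _ (fun p => g (consv p.1 p.2)) (@cube n) t e.
move=> /(_ (@compact_cube n) e0)[].
  by move=> v _; apply: continuous_comp; [exact: continuous_consv|exact: cg].
move=> d d0 dg; exists d => // s /dg {}dg /=.
rewrite -cube_integralB_of//; last 2 first.
- exact: continuous_slicev.
- exact: continuous_slicev.
apply: bnd.
  move=> v; apply: (@continuousB R R^o); exact: continuous_slicev.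
by move=> v /dg vs; rewrite distrC ltW.
Qed.

Lemma cube_linear_bound n : cube_linear n /\ cube_bound n.
Proof.
elim: n => [|n [lin bnd]].
  split=> [a g h _ _//|g M _]; apply.
  by case.
have sc := cube_slice_continuous_of lin bnd.
split=> [a g h cg ch|g M cg gM]; rewrite !cube_integralS.
  rewrite -Rintegral01_linear//; [|exact: sc|exact: sc].
  by apply: eq_Rintegral => t _; rewrite lin//; exact: continuous_slicev.
apply: Rintegral01_norm_le; first exact: sc.
move=> t t01; apply: bnd; first exact: continuous_slicev.
move=> v v01; apply: gM; exact: cube_consv.
Qed.

Lemma cube_integral_linear n (a : R) (g h : 'rV[R]_n -> R) :
  continuous g -> continuous h ->
  cube_integral (fun v => a * g v + h v) = a * cube_integral g + cube_integral h.
Proof. by have [lin _] := cube_linear_bound n; exact: lin. Qed.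

Lemma cube_integral_norm_le n (g : 'rV[R]_n -> R) (M : R) : continuous g ->
  (forall v, cube v -> `|g v| <= M) -> `|cube_integral g| <= M.
Proof. by have [_ bnd] := cube_linear_bound n; exact: bnd. Qed.

Lemma cube_slice_continuous n (g : 'rV[R]_n.+1 -> R) : continuous g ->
  continuous (fun t => cube_integral (fun v : 'rV[R]_n => g (consv t v))).
Proof. by have [lin bnd] := cube_linear_bound n; exact: cube_slice_continuous_of. Qed.

Lemma cube_integralD n (g h : 'rV[R]_n -> R) : continuous g -> continuous h ->
  cube_integral (fun v => g v + h v) = cube_integral g + cube_integral h.
Proof.
move=> cg ch; rewrite -[cube_integral g]mul1r -cube_integral_linear//.
by congr cube_integral; apply/funext => v; rewrite mul1r.
Qed.

Lemma cube_integral_cst n (c : R) : cube_integral (fun _ : 'rV[R]_n => c) = c.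
Proof. by elim: n => // n IH; rewrite cube_integralS IH Rintegral01_cst. Qed.

Lemma cube_integralZ n (a : R) (g : 'rV[R]_n -> R) : continuous g ->
  cube_integral (fun v => a * g v) = a * cube_integral g.
Proof.
move=> cg; rewrite -[RHS]addr0 -[X in _ + X](cube_integral_cst n) -cube_integral_linear//.
  by congr cube_integral; apply/funext => v; rewrite addr0.
exact: cst_continuous.
Qed.

Lemma cube_integralB n (g h : 'rV[R]_n -> R) : continuous g -> continuous h ->
  cube_integral (fun v => g v - h v) = cube_integral g - cube_integral h.
Proof. by have [lin _] := cube_linear_bound n; exact: cube_integralB_of. Qed.

Lemma cube_integral_sum n (I : Type) (r : seq I) (g : I -> 'rV[R]_n -> R) :
  (forall i, continuous (g i)) ->
  cube_integral (fun v => \sum_(i <- r) g i v) = \sum_(i <- r) cube_integral (g i).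
Proof.
move=> cg; elim: r => [|i r IH].
  rewrite big_nil -[RHS](cube_integral_cst n).
  by congr cube_integral; apply/funext => v; rewrite big_nil.
rewrite big_cons -IH -cube_integralD//.
  by congr cube_integral; apply/funext => v; rewrite big_cons.
exact: continuous_bigsum.
Qed.
End CubeIntegral.

(** Formulated by distances to [a], so that increments of either sign are treated alike. *)
Lemma MVT_sym (R : realType) (f df : R -> R) (a b : R) :
    (forall t, `|t - a| <= `|b - a| -> is_derive t (1 : R) f (df t)) ->
  exists2 c, `|c - a| <= `|b - a| & f b - f a = df c * (b - a).
Proof.
move=> fdf.
have cf t : `|t - a| <= `|b - a| -> {for t, continuous f}.
  move=> tab; apply: differentiable_continuous; apply/derivable1_diffP.
  by have [] := fdf t tab.
have [ab|ba] := leP a b.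
  have itv t : t \in `[a, b] -> `|t - a| <= `|b - a|.
    by rewrite in_itv/= => /andP[at_ tb]; rewrite !ger0_norm ?subr_ge0// lerB.
  have [|//|c /itv cab ->] := @MVT_segment R f df a b ab.
    by move=> t tab; apply: fdf; apply: itv; exact: subset_itv_oo_cc.
  - by apply: continuous_in_subspaceT => t /set_mem tab; exact/cf/itv.
  - by exists c.
have itv t : t \in `[b, a] -> `|t - a| <= `|b - a|.
  rewrite in_itv/= => /andP[bt ta].
  by rewrite !ler0_norm ?subr_le0// ?(ltW ba)// lerN2 lerB.
have [||c /itv cab fE] := @MVT_segment R f df b a (ltW ba).
- by move=> t tab; apply: fdf; apply: itv; exact: subset_itv_oo_cc.
- by apply: continuous_in_subspaceT => t /set_mem tab; exact/cf/itv.
by exists c => //; rewrite -opprB fE -mulrN opprB.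
Qed.

(** The hypothesis on [phi] makes the two difference quotients equal as functions of [h], so a
    derivative in one direction is enough. *)
Lemma is_derive_comp_translation (R : realType) (V V' W : normedModType R)
    (F : V -> W) (phi : V' -> V) (v w : V') (w' : V) (d : W) :
    (forall h : R, phi (h *: w + v) = h *: w' + phi v) ->
  is_derive (phi v) w' F d -> is_derive v w (F \o phi) d.
Proof.
move=> phiE [dF dE].
have E : (fun h : R => h^-1 *: ((F \o phi \o shift v) (h *: w) - (F \o phi) v)) =
    (fun h : R => h^-1 *: ((F \o shift (phi v)) (h *: w') - F (phi v))).
  by apply/funext => h /=; rewrite phiE.
by split; rewrite /derivable /derive E.
Qed.

Lemma continuous_fun_sub (R : realType) (T : topologicalType) (g h : T -> R) :
  continuous g -> continuous h -> continuous (fun x => g x - h x).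
Proof. by move=> cg ch x; apply: (@continuousB R R^o); [exact: cg|exact: ch]. Qed.

Lemma continuous_fun_mul (R : realType) (T : topologicalType) (g h : T -> R) :
  continuous g -> continuous h -> continuous (fun x => g x * h x).
Proof. by move=> cg ch x; apply: (@continuousM R); [exact: cg|exact: ch]. Qed.

(** * Differentiation under the integral and derivatives of periodic functions *)

Section DerivCube.
Variable R : realType.

Lemma consvD n (t h : R) (v : 'rV[R]_n) :
  consv (h + t) v = h *: delta_mx ord0 ord0 + consv t v.
Proof.
apply/rowP => i; rewrite [RHS]mxE [X in _ = X + _]mxE [delta_mx _ _ _ _]mxE/=.
case: (unliftP ord0 i) => [j|] ->.
  by rewrite !consvS /= mulr0 add0r.
by rewrite !consv0 eqxx mulr1.
Qed.

Lemma consvDS n (t h : R) (k : 'I_n) (v : 'rV[R]_n) :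
  consv t (h *: delta_mx ord0 k + v) = h *: delta_mx ord0 (lift ord0 k) + consv t v.
Proof.
apply/rowP => i; rewrite [RHS]mxE [X in _ = X + _]mxE [delta_mx _ _ _ _]mxE/=.
case: (unliftP ord0 i) => [j|] ->.
  by rewrite !consvS mxE [X in X + _]mxE mxE (inj_eq lift_inj).
by rewrite !consv0 /= mulr0 add0r.
Qed.

(** The mean value theorem replaces the difference quotient of each slice by [dP] at an intermediate
    time; by compactness of the cube this is close to [dP] at time [t], uniformly in the slice. *)
Lemma is_derive_cube_integral n (P dP : 'rV[R]_n.+1 -> R) (t : R) :
    continuous P -> continuous dP ->
    (forall u, is_derive u (delta_mx ord0 ord0) P (dP u)) ->
  is_derive t (1 : R) (fun s => cube_integral (fun v : 'rV[R]_n => P (consv s v)))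
    (cube_integral (fun v : 'rV[R]_n => dP (consv t v))).
Proof.
move=> cP cdP PdP.
have dslice (v : 'rV[R]_n) s : is_derive s (1 : R) (fun s => P (consv s v)) (dP (consv s v)).
  apply: (@is_derive_comp_translation _ _ _ _ P (fun s => consv s v) _ _
    (delta_mx ord0 ord0)) => //.
  by move=> h; rewrite -consvD /= [h *: 1]mulr1.
set G := fun s => cube_integral (fun v : 'rV[R]_n => P (consv s v)).
set D := cube_integral _.
suff GD : h^-1 *: ((G \o shift t) (h *: 1) - G t) @[h --> 0^'] --> D.
  by split; [exact: cvgP GD|exact: (cvg_lim (@Rhausdorff R) GD)].
apply/cvgrPdist_le => e e0.
have := @near_uniform_compact R _ _ (fun p => dP (consv p.1 p.2)) (@cube R n) t e.
move=> /(_ (@compact_cube R n) e0)[].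
  by move=> v _; apply: continuous_comp; [exact: continuous_consv|exact: cdP].
move=> d d0 dg; near=> h.
have h0 : h != 0 by near: h; exact: nbhs_dnbhs_neq.
have hd : `|h| < d by near: h; exact: dnbhs0_lt.
rewrite /= [h *: 1]mulr1 /G /D.
rewrite -cube_integralB; [|exact: continuous_slicev|exact: continuous_slicev].
have -> (x : R) : h^-1 *: x = h^-1 * x by [].
rewrite -cube_integralZ; last first.
  by apply: continuous_fun_sub; exact: continuous_slicev.
rewrite -cube_integralB; [|exact: continuous_slicev|]; last first.
  apply: continuous_fun_mul; first exact: cst_continuous.
  by apply: continuous_fun_sub; exact: continuous_slicev.
apply: cube_integral_norm_le.
  apply: continuous_fun_sub; first exact: continuous_slicev.
  apply: continuous_fun_mul; first exact: cst_continuous.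
  by apply: continuous_fun_sub; exact: continuous_slicev.
move=> v v01; have [c ct ->] := MVT_sym (b := h + t) (fun s (_ : `|s - t| <= _) => dslice v s).
rewrite addrK mulrCA mulVf// mulr1 distrC ltW//.
apply: dg => //; rewrite /ball /= distrC.
by move: ct; rewrite addrK => /le_lt_trans; apply.
Unshelve. all: by end_near. Qed.

(** If [k] is the outermost variable, the integral is the difference of the slice integrals of [P]
    at 1 and 0, which agree by periodicity. Otherwise the inner integral over each slice vanishes by
    induction. *)
Lemma cube_integral_partial0 n (k : 'I_n) (P dP : 'rV[R]_n -> R) :
    continuous P -> continuous dP ->
    (forall u, is_derive u (delta_mx ord0 k) P (dP u)) ->
    (forall u, P (u + delta_mx ord0 k) = P u) ->
  cube_integral dP = 0.
Proof.
elim: n k P dP => [[]//|n IH] k P dP cP cdP PdP Pper; rewrite cube_integralS.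
case: (unliftP ord0 k) => [j|] kE; subst k.
  rewrite (@eq_Rintegral _ _ _ _ _ (cst 0)) ?Rintegral01_cst// => t _ /=.
  apply: (IH j (fun v => P (consv t v))).
  - exact: continuous_slicev.
  - exact: continuous_slicev.
  - move=> v; apply: (@is_derive_comp_translation _ _ _ _ P (consv t)).
      by move=> h; exact: consvDS.
  - by move=> v; rewrite addrC -[delta_mx _ _]scale1r consvDS scale1r addrC Pper.
have dG t : is_derive t (1 : R) (fun s => cube_integral (fun v : 'rV[R]_n => P (consv s v)))
    (cube_integral (fun v : 'rV[R]_n => dP (consv t v))).
  exact: is_derive_cube_integral.
rewrite (Rintegral01_deriv _ dG); last exact: cube_slice_continuous.
apply/eqP; rewrite subr_eq0; apply/eqP; congr cube_integral; apply/funext => v.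
by rewrite -[1]addr0 consvD scale1r addrC Pper.
Qed.
End DerivCube.

(** * Smooth maps *)

Lemma near_eq_differentiable (R : realType) (V W : normedModType R) (F G : V -> W) (x : V) :
  (\forall y \near x, F y = G y) -> differentiable F x -> differentiable G x.
Proof.
move=> FG dF; have /eqaddoP Fo := diff_locally dF.
have FG0 : \forall h \near (0 : V), F (h + x) = G (h + x).
  by move: FG; rewrite (near_shift 0 x); apply: filterS => h /=; rewrite subr0 addrC.
have Go : G \o shift x = cst (G x) + 'd F x +o_ 0 id.
  apply/eqaddoP => e e0; have := Fo e e0.
  apply: filterS2 FG0 => h; rewrite /= => FGh.
  by rewrite !fctE /= FGh (nbhs_singleton FG).
have dE : 'd G x = 'd F x :> (V -> W).
  by apply: diff_unique Go; exact: diff_continuous.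
apply/diff_locallyP; rewrite dE; split=> //; exact: diff_continuous.
Qed.

Lemma scale_is_bilinear (R : realType) (W : normedModType R) :
  bilinear_for
    (GRing.Scale.Law.clone _ _ *:%R _) (GRing.Scale.Law.clone _ _ *:%R _)
    (@GRing.scale R W).
Proof.
split=> [u'|u] a x y /=.
- by rewrite scalerDl scalerA.
- by rewrite scalerDr !scalerA mulrC.
Qed.

HB.instance Definition _ (R : realType) (W : normedModType R) :=
  bilinear_isBilinear.Build R R W W _ _ (@GRing.scale R W) (scale_is_bilinear W).

Lemma continuous_scale_pair (R : realType) (W : normedModType R) :
  continuous (fun q : R * W => q.1 *: q.2).
Proof. by move=> q; apply: cvgZ; [exact: cvg_fst|exact: cvg_snd]. Qed.

Lemma is_diff_scale_snd (R : realType) (V W : normedModType R) (K : V -> W) (p : R * V) :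
  differentiable K p.2 ->
  is_diff p (fun q : R * V => q.1 *: K q.2) (fun q => p.1 *: ('d K (p.2)) (q.2) + q.1 *: K p.2).
Proof.
move=> dK.
have cfst : continuous (fst : R * V -> R) by move=> ?; exact: cvg_fst.
have csnd : continuous (snd : R * V -> V) by move=> ?; exact: cvg_snd.
have dfst : differentiable (fst : R * V -> R) p by exact: linear_differentiable.
have dsnd : differentiable (snd : R * V -> V) p by exact: linear_differentiable.
have dKs : differentiable (K \o snd) p by exact: differentiable_comp.
pose g (q : R * V) := (q.1, K q.2).
have dg : differentiable g p by exact: differentiable_pair.
have ds : differentiable (fun q : R * W => q.1 *: q.2) (g p).
  exact: differentiable_bilin (@continuous_scale_pair R W).
have -> : (fun q : R * V => q.1 *: K q.2) = (fun q : R * W => q.1 *: q.2) \o g by [].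
split; first exact: differentiable_comp.
rewrite diff_comp// diff_bilin; last exact: continuous_scale_pair.
apply/funext => q /=; rewrite diff_pair// (diff_lin _ cfst) /=.
by rewrite (@diff_comp _ _ _ _ snd K)// (diff_lin _ csnd).
Qed.

Lemma derive_slice (R : realType) (V W : normedModType R) (F : R * V -> W) t x v :
  'D_v (fun y => F (t, y)) x = 'D_(0, v) F (t, x).
Proof.
rewrite /derive.
rewrite (_ : (fun h => h^-1 *: ((_ \o shift x) _ - _)) =
    (fun h : R => h^-1 *: ((F \o shift (t, x)) (h *: ((0, v) : R * V)) - F (t, x))))//.
apply/funext => h /=; congr (_ *: (F _ - _)).
by congr pair; rewrite /= scaler0 add0r.
Qed.

Section Ck.
Variable R : realType.
Implicit Types V W : normedModType R.

Lemma CkS V W k (U : set V) (F : V -> W) : Ck k.+1 U F -> Ck k U F.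
Proof.
elim: k F => [|k IH] F [dF kF]; first by move=> x Ux; exact/differentiable_continuous/dF.
by split=> // v; exact/IH/kF.
Qed.

Lemma eq_Ck V W k (U : set V) (F G : V -> W) : open U ->
  (forall x, U x -> F x = G x) -> Ck k U F -> Ck k U G.
Proof.
move=> oU; elim: k F G => [|k IH] F G FG.
  move=> cF x Ux; apply: near_eq_continuous (cF x Ux) _.
  by apply: filterS (open_nbhs_nbhs (conj oU Ux)) => y; exact: FG.
have FGx x : U x -> \forall y \near x, F y = G y.
  by move=> Ux; apply: filterS (open_nbhs_nbhs (conj oU Ux)) => y; exact: FG.
move=> [dF kF]; split=> [x Ux|v].
  exact: near_eq_differentiable (FGx x Ux) (dF x Ux).
apply: IH (kF v) => x Ux; apply: near_eq_derive; exact: FGx.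
Qed.

(** All conditions in [Ck] concern single points, with derivatives taken in the ambient space, so
    they can be checked point by point. *)
Lemma Ck_local V W k (D : set V) (F : V -> W) :
  (forall x, D x -> exists2 U, U x & Ck k U F) -> Ck k D F.
Proof.
elim: k F => [|k IH] F lF.
  by move=> x /lF[U Ux]; exact.
split=> [x /lF[U Ux [+ _]]|v]; first exact.
by apply: IH => x /lF[U Ux [_ kF]]; exists U => //; exact: kF.
Qed.

Lemma Ck_cst V W k (U : set V) (c : W) : Ck k U (cst c).
Proof.
elim: k c => [|k IH] c; first by move=> x _; exact: cst_continuous.
split=> [x _|v]; first exact: differentiable_cst.
rewrite (_ : (fun x => 'D_v (cst c) x) = cst 0); first exact: IH.
by apply/funext => x; rewrite derive_cst.
Qed.

Lemma Ck_linear V W k (U : set V) (F : {linear V -> W}) : continuous F -> Ck k U F.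
Proof.
move=> cF; have dF x : differentiable F x by exact: linear_differentiable.
case: k => [|k]; first by move=> x _; exact: cF.
split=> // v; rewrite (_ : (fun x => 'D_v F x) = cst (F v)); first exact: Ck_cst.
by apply/funext => x; rewrite deriveE// diff_lin.
Qed.

Lemma CkD V W k (U : set V) (F G : V -> W) : open U ->
  Ck k U F -> Ck k U G -> Ck k U (fun x => F x + G x).
Proof.
move=> oU; elim: k F G => [|k IH] F G.
  by move=> cF cG x Ux; apply: continuousD; [exact: cF|exact: cG].
move=> [dF kF] [dG kG]; split=> [x Ux|v].
  by apply: differentiableD; [exact: dF|exact: dG].
apply: eq_Ck (IH _ _ (kF v) (kG v)) => // x Ux.
by rewrite deriveD//; apply: diff_derivable; [exact: dF|exact: dG].
Qed.

Lemma CkZ V W k (U : set V) (a : R) (F : V -> W) : open U ->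
  Ck k U F -> Ck k U (fun x => a *: F x).
Proof.
move=> oU; elim: k F => [|k IH] F.
  move=> cF x Ux; apply: continuousZr; exact: cF.
move=> [dF kF]; split=> [x Ux|v].
  by apply: differentiableZ; exact: dF.
apply: eq_Ck (IH _ (kF v)) => // x Ux.
by rewrite deriveZ//; apply: diff_derivable; exact: dF.
Qed.

Lemma Ck_slice V W k (D : set (R * V)) (F : R * V -> W) (t : R) :
  Ck k D F -> Ck k [set x | D (t, x)] (fun x => F (t, x)).
Proof.
have dpair x : differentiable (fun x : V => (t, x)) x.
  by apply: (@differentiable_pair _ _ _ _ (cst t) id).
elim: k F => [|k IH] F.
  move=> cF x Dx; apply: (@continuous_comp _ _ _ (fun x => (t, x)) F); last exact: cF.
  exact: differentiable_continuous.
move=> [dF kF]; split=> [x Dx|v].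
  by apply: (@differentiable_comp _ _ _ _ (fun x => (t, x)) F) => //; exact: dF.
rewrite (_ : (fun x => 'D_v (fun x => F (t, x)) x) = fun x => 'D_(0, v) F (t, x)).
  exact: (IH (fun p => 'D_(0, v) F p) (kF _)).
by apply/funext => x; exact: derive_slice.
Qed.

(** The derivative along [(s, v)] is [(D_v G + s K) + t D_v K], again of the same shape; this is why
    the induction runs over all pairs [(G, K)]. *)
Lemma Ck_linear_homotopy V W k (G K : V -> W) : Ck k setT G -> Ck k setT K ->
  Ck k setT (fun p : R * V => G p.2 + p.1 *: K p.2).
Proof.
elim: k G K => [|k IH] G K.
  move=> cG cK p _; apply: continuousD.
    by apply: (@continuous_comp _ _ _ snd G); [exact: cvg_snd|exact: cG].
  apply: continuousZ; first exact: cvg_fst.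
  by apply: (@continuous_comp _ _ _ snd K); [exact: cvg_snd|exact: cK].
move=> [dG kG] [dK kK].
have dGs (p : R * V) : differentiable (G \o snd) p.
  apply: differentiable_comp; last exact: dG.
  by apply: linear_differentiable => ?; exact: cvg_snd.
have dKs (p : R * V) := is_diff_scale_snd (dK p.2 I).
split=> [p _|[s v]].
  by apply: (@differentiableD _ _ _ (G \o snd)) => //; have [] := dKs p.
rewrite (_ : (fun p => 'D_(s, v) _ p) =
  fun p => ('D_v G p.2 + s *: K p.2) + p.1 *: 'D_v K p.2); last first.
  apply/funext => p; rewrite (@deriveD _ _ _ (G \o snd)); last 2 first.
  - exact: diff_derivable.
  - by apply: diff_derivable; have [] := dKs p.
  rewrite [X in _ + X]deriveE; last by have [] := dKs p.
  have -> := @diff_val _ _ _ _ _ _ _ (dKs p).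
  rewrite deriveE// diff_comp//; last 2 first.
  - by apply: linear_differentiable => ?; exact: cvg_snd.
  - exact: dG.
  rewrite /= diff_lin/=; last by move=> ?; exact: cvg_snd.
  rewrite (deriveE _ (dG p.2 I)) (deriveE _ (dK p.2 I)).
  by rewrite [X in _ + X]addrC addrA.
apply: (IH (fun x => 'D_v G x + s *: K x) (fun x => 'D_v K x)); last exact: kK.
apply: CkD; [exact: openT|exact: kG|apply: CkZ; first exact: openT].
by apply: CkS; split.
Qed.

End Ck.

(** * Energy and harmonic maps *)

Lemma continuous_fun_add (R : realType) (T : topologicalType) (g h : T -> R) :
  continuous g -> continuous h -> continuous (fun x => g x + h x).
Proof. by move=> cg ch x; apply: (@continuousD R R^o); [exact: cg|exact: ch]. Qed.

Section SmoothLifts.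
Variables (R : realType) (V : normedModType R) (n : nat) (L : zmodClosed 'rV[R]_n).
Hypothesis Ld : discrete_lattice L.
Implicit Types (f : V -> torus L) (F : V -> 'rV[R]_n).

Lemma smooth_locally_lifts f (D : set V) : (forall x, D x -> smooth_at f x) ->
  locally_lifts f D.
Proof.
move=> fD x /fD[F [U [oU Ux sF fF]]].
have [e /= e0 eU] : nbhs_ball x U.
  by apply/nbhs_ballP; exact: open_nbhs_nbhs.
exists e => //; exists F => y yx.
have Uy : U y by apply: eU; rewrite -ball_normE /= distrC.
by split; [exact: (sF 0%N)|exact: fF].
Qed.

(** Near each point a continuous lift differs by a constant from the smooth local lift provided by
    [smooth_at]. *)
Lemma lifts_on_smooth f (D : set V) F : open D -> (forall x, D x -> smooth_at f x) ->
  lifts_on D f F -> smooth_on D F.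
Proof.
move=> oD fD fF k; apply: Ck_local => x Dx.
have [G [U [oU Ux sG fG]]] := fD x Dx.
have [cF fFx] := fF x Dx; have cG : {for x, continuous G} := sG 0%N x Ux.
have : nbhs x [set y | f y = \pi_(torus L) (F y) -> f y = \pi_(torus L) (G y) ->
    F y - G y = F x - G x] := lifts_near_eq Ld cF cG fFx (fG x Ux).
rewrite nbhsE => -[W [oW Wx] WE].
exists (W `&` (U `&` D)); first by [].
apply: (@eq_Ck _ _ _ _ _ (fun y => G y + (F x - G x))).
- by apply: openI => //; exact: openI.
- move=> y [Wy [Uy Dy]]; rewrite -(WE y Wy) ?subrKC//; last exact: fG.
  by have [] := fF y Dy.
apply: CkD; last exact: Ck_cst.
  by apply: openI => //; exact: openI.
by apply: Ck_local => y [_ [Uy _]]; exists U => //; exact: sG.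
Qed.

Lemma global_smooth_lift f (D : set V) (p : V) (w : 'rV[R]_n) :
    open D -> D p -> star_shaped p D -> (forall x, D x -> smooth_at f x) ->
    f p = \pi_(torus L) w ->
  exists F, [/\ smooth_on D F, lifts_on D f F & F p = w].
Proof.
move=> oD Dp sD fD fp.
have [F fF Fp] := global_lift Ld oD Dp sD (smooth_locally_lifts fD) fp.
by exists F; split=> //; exact: lifts_on_smooth fF.
Qed.
End SmoothLifts.

Section Derivatives.
Variables (R : realType).

Lemma continuous_mulmxr m n p (A : 'M[R]_(n, p)) : continuous (fun u : 'M[R]_(m, n) => u *m A).
Proof.
move=> u; apply: continuous_mx => i j.
rewrite (_ : (fun _ => _) = (fun u : 'M[R]_(m, n) => \sum_k u i k * A k j)); last first.
  by apply/funext => v; rewrite mxE.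
apply: (@continuous_bigsum R _ R^o) => k.
apply: continuous_fun_mul; last exact: cst_continuous.
exact: coord_continuous.
Qed.

Lemma jacobian_entry m n (F : 'rV[R]_m -> 'rV[R]_n) x i j : differentiable F x ->
  'J F x i j = 'D_(delta_mx ord0 i) F x ord0 j.
Proof. by move=> dF; rewrite (deriveEjacobian _ dF) -rowE [RHS]mxE. Qed.

Lemma derive_entry (V : normedModType R) m n (F : V -> 'M[R]_(m, n)) x v i j :
  derivable F x v -> 'D_v F x i j = 'D_v (fun y => F y i j) x.
Proof. by move=> dF; rewrite derive_mx// mxE. Qed.

Lemma is_derive_entry (V : normedModType R) m n (F : V -> 'M[R]_(m, n)) x v i j :
  derivable F x v -> is_derive x v (fun y => F y i j) ('D_v F x i j).
Proof.
move=> dF; split; last by rewrite derive_entry.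
by have /derivable_mxP := dF; apply.
Qed.

Lemma smooth_differentiable (V W : normedModType R) (F : V -> W) x :
  smooth_on setT F -> differentiable F x.
Proof. by move=> sF; have [dF _] := sF 1%N; exact: dF. Qed.

Lemma smooth_derive (V W : normedModType R) (U : set V) (F : V -> W) v :
  smooth_on U F -> smooth_on U (fun x => 'D_v F x).
Proof. by move=> sF k; have [_ kF] := sF k.+1; exact: kF. Qed.

Lemma smooth_continuous (V W : normedModType R) (F : V -> W) :
  smooth_on setT F -> continuous F.
Proof. by move=> sF x; exact: (sF 0%N). Qed.
End Derivatives.

Section Energy.
Variables (R : realType) (m n : nat) (A : 'M[R]_m) (L : zmodClosed 'rV[R]_n).
Hypotheses (Ld : discrete_lattice L) (Au : A \in unitmx).
Local Notation T := (torus (basis_lattice A)).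
Implicit Types (f g : T -> torus L) (F G : 'rV[R]_m -> 'rV[R]_n) (X Y : 'M[R]_(m, n)).

Definition normsq_jac F (x : 'rV[R]_m) : R :=
  \sum_i \sum_j ('D_(delta_mx ord0 i) F x ord0 j) ^+ 2.

(** The global lift [F] shows that [xget] does not return its default, and the lift it selects
    differs from [F] by a constant near [x], hence has the same Jacobian there. *)
Lemma normsq_diff_lift f F x : smooth_on setT F -> is_lift f F ->
  normsq_diff f x = normsq_jac F x.
Proof.
move=> sF fF; rewrite /normsq_diff /normsq_jac.
have dFx := smooth_differentiable x sF.
have -> : \sum_i \sum_j ('D_(delta_mx ord0 i) F x ord0 j) ^+ 2 =
          \sum_i \sum_j ('J F x i j) ^+ 2.
  by apply: eq_bigr => i _; apply: eq_bigr => j _; rewrite jacobian_entry.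
case: xgetP => [_ _ [G [U [oU Ux sG fG]] ->]|]; last first.
  move=> /(_ (\sum_i \sum_j ('J F x i j) ^+ 2))[]; exists F => //.
  by exists setT; split=> //; [exact: openT|move=> y _; exact: fF].
suff -> : 'J G x = 'J F x by [].
have [dG _] := sG 1%N; have {}dG := dG x Ux.
apply/matrixP => i j.
apply: etrans (jacobian_entry i j dG) _; apply: etrans _ (esym (jacobian_entry i j dFx)).
suff -> : 'D_(delta_mx ord0 i) G x = 'D_(delta_mx ord0 i) F x by [].
have cF : {for x, continuous F} by exact: smooth_continuous.
have GF := lifts_near_eq Ld (sG 0%N x Ux) cF (fG x Ux) (fF x).
transitivity ('D_(delta_mx ord0 i) (F + cst (G x - F x)) x).
  apply: near_eq_derive; move: GF (open_nbhs_nbhs (conj oU Ux)).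
  apply: filterS2 => y GFy Uy; rewrite !fctE.
  by rewrite -(GFy (fG y Uy) (fF y)) subrKC.
rewrite deriveD; last exact: derivable_cst.
  by rewrite derive_cst addr0.
exact: diff_derivable.
Qed.

Lemma continuous_entry_mulmx F j : continuous F ->
  continuous (fun u : 'rV[R]_m => F (u *m A) ord0 j).
Proof.
move=> cF u; apply: (@continuous_comp _ _ _ (fun u : 'rV[R]_m => F (u *m A)) (fun v => v ord0 j)).
  apply: (@continuous_comp _ _ _ (fun u : 'rV[R]_m => u *m A) F); last exact: cF.
  exact: continuous_mulmxr.
exact: coord_continuous.
Qed.

Lemma continuous_derive_entry F (v : 'rV[R]_m) j : smooth_on setT F ->
  continuous (fun u : 'rV[R]_m => 'D_v F (u *m A) ord0 j).
Proof.
move=> sF; apply: (@continuous_entry_mulmx (fun x => 'D_v F x)).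
exact/smooth_continuous/smooth_derive.
Qed.

Lemma continuous_normsq_jac F : smooth_on setT F ->
  continuous (fun u : 'rV[R]_m => normsq_jac F (u *m A)).
Proof.
move=> sF; apply: (@continuous_bigsum R _ R^o) => i; apply: (@continuous_bigsum R _ R^o) => j.
by under eq_fun do rewrite expr2; apply: continuous_fun_mul; exact: continuous_derive_entry.
Qed.

(** In the coordinates [u] with [x = u A], the derivative along [row k A] is a coordinate derivative
    of a function of period 1, so it integrates to zero. The standard basis vectors are combinations
    of these rows, with the entries of [invmx A] as coefficients. *)
Lemma cube_integral_derive_periodic (psi : 'rV[R]_m -> 'rV[R]_n) i j :
    smooth_on setT psi -> (forall k x, psi (x + row k A) = psi x) ->
  cube_integral (fun u => 'D_(delta_mx ord0 i) psi (u *m A) ord0 j) = 0.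
Proof.
move=> sp pp.
have cA : continuous (fun u : 'rV[R]_m => u *m A) by exact: continuous_mulmxr.
have cDp (v : 'rV[R]_m) : continuous (fun u : 'rV[R]_m => 'D_v psi (u *m A) ord0 j).
  exact: continuous_derive_entry.
have row0 k : cube_integral (fun u => 'D_(row k A) psi (u *m A) ord0 j) = 0.
  apply: (@cube_integral_partial0 _ _ k (fun u => psi (u *m A) ord0 j)) => //.
  - apply: continuous_entry_mulmx; exact: smooth_continuous.
  - move=> u.
    apply: (@is_derive_comp_translation _ _ _ _ (fun x => psi x ord0 j)
      (fun u => u *m A) _ _ (row k A)).
      by move=> h; rewrite mulmxDl -scalemxAl -rowE.
    apply: is_derive_entry; apply: diff_derivable; exact: smooth_differentiable.
  - by move=> u; rewrite mulmxDl -rowE pp.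
transitivity (\sum_k (invmx A) i k * cube_integral (fun u => 'D_(row k A) psi (u *m A) ord0 j)).
  rewrite -(eq_bigr _ (fun k _ => cube_integralZ (invmx A i k) (cDp (row k A)))).
  rewrite -cube_integral_sum.
  congr cube_integral; apply/funext => u.
  have dp := smooth_differentiable (u *m A) sp.
  have -> : delta_mx ord0 i = \sum_k invmx A i k *: row k A.
    transitivity (row i (invmx A *m A)); first by rewrite mulVmx// rowE mulmx1.
    by rewrite row_mul mulmx_sum_row; apply: eq_bigr => k _; rewrite mxE.
  rewrite deriveE// linear_sum summxE; apply: eq_bigr => k _.
    by rewrite linearZ mxE -deriveE.
  move=> k; apply: continuous_fun_mul => //; exact: cst_continuous.
by rewrite big1// => k _; rewrite row0 mulr0.
Qed.

Lemma energy_lift f (B : 'M[R]_(m, n)) (psi : 'rV[R]_m -> 'rV[R]_n) :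
    smooth_on setT psi -> (forall k x, psi (x + row k A) = psi x) ->
    is_lift f (fun x => x *m B + psi x) ->
  energy f = 2^-1 * (`|\det A| * (\sum_i \sum_j B i j ^+ 2 +
    cube_integral (fun u : 'rV[R]_m => normsq_jac psi (u *m A)))).
Proof.
move=> sp pp fF; rewrite /energy /normsq_jac; congr (_ * (_ * _)).
pose g i j (u : 'rV[R]_m) := 'D_(delta_mx ord0 i) psi (u *m A) ord0 j.
have cg i j : continuous (g i j) by exact: continuous_derive_entry.
have cg2 i j : continuous (fun u => g i j u ^+ 2).
  by under eq_fun do rewrite expr2; exact: continuous_fun_mul.
have cmB : continuous (fun x : 'rV[R]_m => x *m B) by exact: continuous_mulmxr.
have sF : smooth_on setT (fun x => x *m B + psi x).
  move=> k; apply: CkD; [exact: openT| |exact: sp].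
  exact: (@Ck_linear _ _ _ _ _ (mulmxr B)).
(* The cross term is put in front, in the form [a * g + h] that [cube_integral_linear] splits
   off. *)
have -> : (fun t => normsq_diff f (t *m A)) =
    (fun u => \sum_i \sum_j ((2 * B i j) * g i j u + (B i j ^+ 2 + g i j u ^+ 2))).
  apply/funext => u; rewrite (normsq_diff_lift _ sF fF).
  apply: eq_bigr => i _; apply: eq_bigr => j _.
  have dp := smooth_differentiable (u *m A) sp.
  have dB : differentiable (fun x : 'rV[R]_m => x *m B) (u *m A).
    exact: (@linear_differentiable _ _ _ (mulmxr B)).
  rewrite (@deriveD _ _ _ (fun x : 'rV[R]_m => x *m B) psi); last 2 first.
  - exact: diff_derivable.
  - exact: diff_derivable.
  rewrite deriveE// (@diff_lin _ _ _ (mulmxr B))//= mxE -rowE mxE -/(g i j u).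
  ring.
have cterm i j : continuous (fun u => B i j ^+ 2 + g i j u ^+ 2).
  by apply: continuous_fun_add; [exact: cst_continuous|exact: cg2].
have cterm2 i j : continuous (fun u => (2 * B i j) * g i j u + (B i j ^+ 2 + g i j u ^+ 2)).
  apply: continuous_fun_add; last exact: cterm.
  by apply: continuous_fun_mul; [exact: cst_continuous|exact: cg].
have csum i : continuous (fun u => \sum_j ((2 * B i j) * g i j u + (B i j ^+ 2 + g i j u ^+ 2))).
  exact: (@continuous_bigsum R _ R^o).
have csum2 i : continuous (fun u => \sum_j (g i j u ^+ 2)).
  exact: (@continuous_bigsum R _ R^o).
rewrite !cube_integral_sum// -big_split; apply: eq_bigr => i _ /=.
rewrite !cube_integral_sum//.
rewrite -big_split; apply: eq_bigr => j _ /=.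
rewrite cube_integral_linear//.
rewrite cube_integral_derive_periodic// mulr0 add0r cube_integralD//.
  by rewrite cube_integral_cst.
  exact: cst_continuous.
by move=> j; exact: (cg2 i).
Qed.
End Energy.

Lemma is_derive_quadratic (R : realType) (phi : R -> R) (l C e : R) : 0 < e ->
    (forall t, `|t| < e -> `|phi t - phi 0 - t * l| <= C * t ^+ 2) ->
  is_derive (0 : R) (1 : R) phi l.
Proof.
move=> e0 phiC.
suff GD : h^-1 *: ((phi \o shift 0) (h *: 1) - phi 0) @[h --> 0^'] --> l.
  by split; [exact: cvgP GD|exact: (cvg_lim (@Rhausdorff R) GD)].
apply/cvgrPdist_le => d d0; near=> h.
have h0 : h != 0 by near: h; exact: nbhs_dnbhs_neq.
have he : `|h| < e by near: h; exact: dnbhs0_lt.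
(* This makes [|C| * |h|] at most [d]; the summand 1 covers [C = 0]. *)
have hd : `|h| < d / (`|C| + 1).
  by near: h; apply: dnbhs0_lt; rewrite divr_gt0// ltr_wpDl.
rewrite /= addr0 [h *: 1]mulr1.
have -> : l - h^-1 *: (phi h - phi 0) = - (h^-1 * (phi h - phi 0 - h * l)).
  by rewrite mulrBr mulrA mulVf// mul1r opprB.
rewrite normrN normrM normfV ler_pdivrMl ?normr_gt0//.
apply: le_trans (phiC h he) _.
rewrite -real_normK ?num_real// expr2 mulrCA ler_wpM2l//.
apply: le_trans (_ : (`|C| + 1) * `|h| <= _).
  by rewrite ler_wpM2r//; apply: le_trans (ler_norm C) _; rewrite lerDl.
by rewrite -ler_pdivlMl ?ltr_wpDl// mulrC ltW.
Unshelve. all: by end_near. Qed.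

Lemma continuous_shift_at (R : realType) (V W : normedModType R) (F : V -> W) (v x : V) :
  {for x + v, continuous F} -> {for x, continuous (fun y => F (y + v))}.
Proof.
move=> cF; apply: (@continuous_comp _ _ _ (fun y => y + v) F); last exact: cF.
by apply: continuousD; [move=> ?|exact: cst_continuous].
Qed.

Lemma continuous_comp_snd (R : realType) (V V' W : normedModType R) (F : R * V -> W)
    (phi : V' -> V) (p : R * V') : continuous phi ->
  {for (p.1, phi p.2), continuous F} -> {for p, continuous (fun q => F (q.1, phi q.2))}.
Proof.
move=> cphi cF; apply: (@continuous_comp _ _ _ (fun q : R * V' => (q.1, phi q.2)) F);
  last exact: cF.
have c2 : phi q.2 @[q --> p] --> phi p.2.
  by apply: (@cvg_comp _ _ _ snd phi _ (nbhs p.2)); [exact: cvg_snd|exact: cphi].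
exact: (@cvg_pair _ R V (nbhs p) (nbhs p.1) (nbhs (phi p.2)) _ _ _ fst (phi \o snd) cvg_fst c2).
Qed.

Lemma compact_norm_bound (R : realType) (T : topologicalType) (W : normedModType R)
    (F : T -> W) (K : set T) : K !=set0 -> compact K ->
    (forall p, K p -> {for p, continuous F}) ->
  exists2 M : R, 0 <= M & forall p, K p -> `|F p| <= M.
Proof.
move=> K0 cK cF.
have cq p : K p -> {for p, continuous (fun p => `|F p|)} by move=> Kp; apply: cvg_norm; exact: cF.
have [p _ pM] := @compact_EVT_max _ R _ K K0 cK
  (continuous_in_subspaceT (fun p pK => cq p (set_mem pK))).
by exists `|F p| => // q Kq; apply: pM; exact/mem_set.
Qed.

(** * Energies of harmonic maps and their homotopy classes *)

Section Harmonic.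
Variables (R : realType) (m n : nat) (A : 'M[R]_m) (L : zmodClosed 'rV[R]_n).
Hypotheses (Ld : discrete_lattice L) (Au : A \in unitmx).
Local Notation T := (torus (basis_lattice A)).
Implicit Types (f g : T -> torus L) (F G : 'rV[R]_m -> 'rV[R]_n) (X Y : 'M[R]_(m, n)).

(** The energy of the linear map with matrix [invmx A *m X], the one that sends [row i A] to
    [row i X]; [|det A|] is the volume of the source torus. *)
Definition torus_energy X : R :=
  2^-1 * (`|\det A| * (\sum_i \sum_j (invmx A *m X) i j ^+ 2)).

Lemma smooth_on_mulmxr B k : Ck k setT (fun x : 'rV[R]_m => x *m B : 'rV[R]_n).
Proof. by apply: (@Ck_linear _ _ _ _ _ (mulmxr B)); exact: continuous_mulmxr. Qed.

Lemma smooth_map_lift f : smooth_map f ->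
  exists F, smooth_on setT F /\ is_lift f F.
Proof.
move=> sf.
have [F [sF fF _]] : exists F, [/\ smooth_on setT F, lifts_on setT (f \o \pi_T) F &
    F 0 = repr (f (\pi_T 0))].
  by apply: global_smooth_lift => //; [exact: openT|rewrite /= reprK].
by exists F; split=> // x; have [_] := fF x I.
Qed.

(* Write the lift of [f] as [x *m B + psi x] with [psi] periodic.  Along the
   variation [x *m B + (1 - t) *: psi x] the energy is that of the linear map plus
   [(1 - t) ^+ 2] times the Dirichlet energy of [psi], which therefore vanishes. *)
Lemma harmonic_energy f X : harmonic_map f -> monodromy f X ->
  energy f = torus_energy X.
Proof.
move=> [sf hf] fX; have XL i := monodromy_mem i fX.
have [F [sF fF]] := smooth_map_lift sf.
(* The smooth lift has some matrix [Y] of increments; uniqueness of the monodromy identifies it with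
   [X]. *)
have FX : equivariant A F X.
  have [Y FY] := lift_equivariant Ld (smooth_continuous sF) fF.
  suff -> : X = Y by [].
  apply: (monodromy_inj Ld fX); exists F => //; exact: smooth_continuous.
pose B := invmx A *m X.
have rowB k : row k A *m B = row k X by rewrite -row_mul mulmxA mulmxV// mul1mx.
pose psi x := F x - x *m B.
have sp : smooth_on setT psi.
  move=> k; apply: (@eq_Ck _ _ _ _ _ (fun x => F x + -1 *: (x *m B))); first exact: openT.
    by move=> x _; rewrite scaleN1r.
  by apply: CkD; [exact: openT|exact: sF|apply: CkZ; [exact: openT|exact: smooth_on_mulmxr]].
have pp k x : psi (x + row k A) = psi x.
  by rewrite /psi FX mulmxDl rowB opprD addrACA subrr addr0.
pose Ft (t : R) x := x *m B + (1 - t) *: psi x.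
have FtX t : equivariant A (Ft t) X.
  by move=> k x; rewrite /Ft pp mulmxDl rowB addrAC.
pose H t : T -> torus L := @descend R m n A L (Ft t).
have HF t : is_lift (H t) (Ft t) by apply: descendE; exact: equivariantB_mem XL.
have H0 : H 0 = f.
  apply: (is_lift_inj (HF 0)) => x; rewrite fF; congr (\pi_(torus L) _).
  by rewrite /Ft subr0 scale1r /psi subrKC.
set c := 2^-1 * `|\det A|.
set S := \sum_i \sum_j B i j ^+ 2.
pose I := cube_integral (fun u : 'rV[R]_m => normsq_jac psi (u *m A)).
have EH t : energy (H t) = c * (S + (1 - t) ^+ 2 * I).
  have spt : smooth_on setT (fun x => (1 - t) *: psi x).
    by move=> k; apply: CkZ; [exact: openT|exact: sp].
  rewrite (energy_lift Ld Au spt _ (HF t)); last by move=> k x; rewrite pp.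
  rewrite mulrA -/c -/S; congr (_ * (_ + _)).
  rewrite -cube_integralZ; last exact: continuous_normsq_jac.
  congr cube_integral; apply/funext => u.
  rewrite mulr_sumr; apply: eq_bigr => i _; rewrite mulr_sumr; apply: eq_bigr => j _.
  rewrite deriveZ; last by apply: diff_derivable; exact: smooth_differentiable.
  by rewrite mxE exprMn.
have dE : is_derive (0 : R) (1 : R) (fun t => energy (H t)) 0.
  (* The variation is smooth for all times, so [eps = 1] serves. Its lift is rewritten as [F] plus
     [t] times [- psi], the shape covered by [Ck_linear_homotopy]. *)
  apply: (hf 1) => // t x _.
  exists (fun p : R * 'rV[R]_m => F p.2 + p.1 *: (-1 *: psi p.2)), setT.
  split=> //; first exact: openT.
    move=> k; apply: (@Ck_linear_homotopy _ _ _ _ F (fun x => -1 *: psi x)); first exact: sF.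
    by apply: CkZ; [exact: openT|exact: sp].
  move=> [s y] _ /=; rewrite HF; congr (\pi_(torus L) _).
  by rewrite /Ft scalerBl scale1r scaleN1r scalerN addrA /psi subrKC.
(* Expanding [(1 - t) ^+ 2] leaves the exact remainder [c * I * t ^+ 2]. Comparing this derivative
   with the zero derivative of a stationary map yields [c * I = 0]. *)
have dE' : is_derive (0 : R) (1 : R) (fun t => energy (H t)) (- (2 * (c * I))).
  apply: (@is_derive_quadratic _ _ _ (`|c * I|) 1) => // t _.
  rewrite !EH subr0 expr1n mul1r.
  have -> : c * (S + (1 - t) ^+ 2 * I) - c * (S + I) - t * - (2 * (c * I)) =
      (c * I) * t ^+ 2 by ring.
  by rewrite normrM (ger0_norm (sqr_ge0 t)).
have cI0 : c * I = 0.
  have := @derive_val _ _ _ _ _ _ _ dE; rewrite (@derive_val _ _ _ _ _ _ _ dE') => /eqP.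
  by rewrite oppr_eq0 mulf_eq0 pnatr_eq0 /= => /eqP.
by rewrite -H0 EH subr0 expr1n mul1r mulrDr cI0 addr0 /torus_energy mulrA.
Qed.

Lemma affine_smooth f B : is_lift f (fun x => x *m B) -> smooth_map f.
Proof.
move=> fB x; exists (fun x => x *m B), setT; split=> //; first exact: openT.
  by move=> k; exact: smooth_on_mulmxr.
by move=> y _; exact: fB.
Qed.

(** The slab [|t| < eps] is convex, so the variation lifts over all of it. The value 0 at the origin
    makes the lift equal to [x *m B] at time 0, and increments along lattice vectors are constant
    over the slab, hence known from time 0. *)
Lemma affine_variation_lift f B (eps : R) (H : R -> T -> torus L) :
    is_lift f (fun x => x *m B) -> 0 < eps -> smooth_variation eps H -> H 0 = f ->
  exists Phi : R * 'rV[R]_m -> 'rV[R]_n,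
    [/\ smooth_on [set p | `|p.1| < eps] Phi,
        forall x, Phi (0, x) = x *m B,
        forall t, `|t| < eps -> is_lift (H t) (fun x => Phi (t, x)) &
        forall t x k, `|t| < eps -> Phi (t, x + row k A) = Phi (t, x) + row k A *m B].
Proof.
move=> fB eps0 sH H0.
pose D : set (R * 'rV[R]_m) := [set p | `|p.1| < eps].
pose fH (p : R * 'rV[R]_m) := H p.1 (\pi_T p.2).
have oD : open D.
  apply: (@open_comp _ _ fst [set t : R | `|t| < eps]).
    by move=> p _; exact: cvg_fst.
  by rewrite (_ : [set _ | _] = [set t : R | `|t - 0| < eps]);
    [exact: (@open_norm_lt R R^o)|apply/seteqP; split=> t /=; rewrite subr0].
have D0 : D (0, 0) by rewrite /D /= normr0.
have cD : cvx D.
  by move=> p q s /= pe qe s01; exact: (@lerp_norm_lt R R^o).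
have sfH p : D p -> smooth_at fH p by case: p => t x; exact: sH.
have [Phi [sPhi lPhi Phi0]] : exists F : R * 'rV[R]_m -> 'rV[R]_n,
    [/\ smooth_on D F, lifts_on D fH F & F (0, 0) = 0].
  apply: global_smooth_lift => //.
  - by move=> p s Dp; exact: cD.
  - by rewrite /fH /= H0 fB mul0mx.
have PhiB x : Phi (0, x) = x *m B.
  have c0 : continuous (fun x => Phi (0, x)).
    move=> y; apply: (@Ck_slice _ _ _ 0%N D Phi 0 (sPhi 0%N)).
    by rewrite /D /= normr0.
  have cB : continuous (fun x : 'rV[R]_m => x *m B) by exact: continuous_mulmxr.
  apply: subr0_eq; rewrite (@lift_diff_const _ _ _ Ld _ (f \o \pi_T) _ _ c0 cB _ _ x 0).
  - by rewrite Phi0 mul0mx subrr.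
  - move=> y /=; have [_] := lPhi (0, y) D0.
    by rewrite /fH /= H0.
  - exact: fB.
exists Phi; split=> //.
  by move=> t te x; have [_ <-] := lPhi (t, x) te.
move=> t x k te; apply/eqP; rewrite [eqbRHS]addrC -subr_eq; apply/eqP.
have sh p : p + (0, row k A) = (p.1, p.2 + row k A) :> R * 'rV[R]_m.
  by rewrite [LHS]/GRing.add /= /add_pair /= addr0.
have -> : row k A *m B = Phi (0, row k A) - Phi (0, 0) by rewrite Phi0 subr0 PhiB.
have := @lifts_on_diff _ _ _ _ Ld D fH (fun p => Phi (p + (0, row k A))) Phi (t, x) (0, 0).
rewrite !sh /= add0r; apply=> //; first exact: cvx_connected.
move=> p Dp; rewrite sh.
have [cP fP] := lPhi (p.1, p.2 + row k A) Dp; split; last first.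
  by rewrite -fP /fH /= pi_row.
move: cP; rewrite -sh => cP.
exact: continuous_shift_at.
Qed.

(* The periodic part [psi t] of the lift vanishes at [t = 0], so its derivatives
   in [x] are O(t) and the energy changes by O(t^2). *)
Lemma affine_harmonic f B : is_lift f (fun x => x *m B) -> harmonic_map f.
Proof.
move=> fB; split; first exact: affine_smooth fB.
move=> eps H eps0 sH H0.
have [Phi [sPhi PhiB HPhi PhiP]] := affine_variation_lift fB eps0 sH H0.
pose D : set (R * 'rV[R]_m) := [set p | `|p.1| < eps].
pose psi t x := Phi (t, x) - x *m B.
have sPhit t : `|t| < eps -> smooth_on setT (fun x => Phi (t, x)).
  move=> te k; have -> : [set: 'rV[R]_m] = [set x | D (t, x)] by apply/seteqP; split.
  exact: Ck_slice.
have sp t : `|t| < eps -> smooth_on setT (psi t).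
  move=> te k; apply: (@eq_Ck _ _ _ _ _ (fun x => Phi (t, x) + -1 *: (x *m B))); first exact: openT.
    by move=> x _; rewrite scaleN1r.
  by apply: CkD; [exact: openT|exact: sPhit|apply: CkZ; [exact: openT|exact: smooth_on_mulmxr]].
have pp t : `|t| < eps -> forall k x, psi t (x + row k A) = psi t x.
  by move=> te k x; rewrite /psi PhiP// mulmxDl opprD addrACA subrr addr0.
have psi0 : psi 0 = cst 0 by apply/funext => x; rewrite /psi PhiB subrr.
pose Q t := cube_integral (fun u : 'rV[R]_m => normsq_jac (psi t) (u *m A)).
set c := 2^-1 * `|\det A|.
have EH t : `|t| < eps -> energy (H t) = c * (\sum_i \sum_j B i j ^+ 2 + Q t).
  move=> te; rewrite -mulrA; apply: (energy_lift Ld Au (sp t te) (pp t te)).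
  by move=> x; rewrite HPhi// /psi subrKC.
have Q0 : Q 0 = 0.
  rewrite /Q -[RHS](cube_integral_cst m 0); congr cube_integral; apply/funext => u.
  rewrite /normsq_jac big1// => i _; rewrite big1// => j _.
  by rewrite psi0 derive_cst mxE expr0n.
(* The mixed derivative of the lift, along the i-th coordinate of [x] and then along time. It is
   bounded over the compact product of [|t| <= eps / 2] with the cube; time is halved because
   smoothness holds on the open slab. *)
pose ki i p := 'D_(1, 0) (fun p => 'D_(0, delta_mx ord0 i) Phi p) p.
have ski i : smooth_on D (ki i).
  by apply: (@smooth_derive _ _ _ D (fun p => 'D_(0, delta_mx ord0 i) Phi p)); exact: smooth_derive.
have [M M0 kM] : exists2 M : R, 0 <= M & forall i s u, `|s| <= eps / 2 -> cube u ->
    `|ki i (s, u *m A)| <= M.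
  have kMi i : exists2 M : R, 0 <= M & forall s u, `|s| <= eps / 2 -> cube u ->
      `|ki i (s, u *m A)| <= M.
    pose K : set (R * 'rV[R]_m) := `[- (eps / 2), eps / 2]%classic `*` @cube R m.
    have Ke p : K p -> `|p.1| <= eps / 2.
      by move=> [/= + _]; rewrite in_itv/= ler_norml.
    have cK : compact K by apply: compact_setX; [exact: segment_compact|exact: compact_cube].
    have K0 : K !=set0.
      exists (0, 0); split; first by rewrite /= in_itv/= oppr_le0; apply/andP; split; lra.
      by move=> k; rewrite mxE /= in_itv/= lexx ler01.
    have [p Kp|M M0 KM] := @compact_norm_bound R _ _
        (fun p : R * 'rV[R]_m => ki i (p.1, p.2 *m A)) K K0 cK.
      apply: (@continuous_comp_snd R _ _ _ (ki i) (fun u : 'rV[R]_m => u *m A) p).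
        exact: continuous_mulmxr.
      by apply: (ski i 0%N); rewrite /D /=; have := Ke _ Kp; lra.
    exists M => // s u se u01; apply: (KM (s, u)); split=> //=.
    by rewrite in_itv/= -ler_norml.
  pose Mi i := sval (cid2 (kMi i)).
  have MiP i : 0 <= Mi i /\ forall s u, `|s| <= eps / 2 -> cube u -> `|ki i (s, u *m A)| <= Mi i.
    by rewrite /Mi; case: cid2.
  exists (\sum_i Mi i); first by apply: sumr_ge0 => i _; have [] := MiP i.
  move=> i s u se u01; apply: le_trans ((MiP i).2 s u se u01) _.
  by rewrite (bigD1 i)//= lerDl; apply: sumr_ge0 => k _; have [] := MiP k.
have dpsi i j t u : `|t| < eps / 2 -> cube u ->
    `|'D_(delta_mx ord0 i) (psi t) (u *m A) ord0 j| <= M * `|t|.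
  move=> te u01; set x := u *m A; set ei := delta_mx ord0 i.
  pose G s := 'D_(0, ei) Phi (s, x) ord0 j.
  have dB v : 'D_v (fun y : 'rV[R]_m => y *m B) x = v *m B.
    have cB : continuous (mulmxr B : 'rV[R]_m -> 'rV[R]_n) by exact: continuous_mulmxr.
    rewrite deriveE; last exact: (@linear_differentiable _ _ _ (mulmxr B)).
    by rewrite (@diff_lin _ _ _ (mulmxr B)).
  have G0 : G 0 = (ei *m B) ord0 j.
    have PhiBE : (fun y => Phi (0, y)) = (fun y => y *m B) by apply/funext => y; exact: PhiB.
    have dPhi0 : 'D_(0, ei) Phi (0, x) = ei *m B by rewrite -derive_slice PhiBE dB.
    by rewrite /G dPhi0.
  have te' : `|t| < eps by lra.
  (* The linear part contributes the value of [G] at time 0, so the mean value theorem in time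
     applies to [G], whose derivative is an entry of [ki i]. *)
  have -> : 'D_ei (psi t) x ord0 j = G t - G 0.
    suff dpsiE : 'D_ei (psi t) x = 'D_(0, ei) Phi (t, x) - ei *m B.
      by rewrite G0 /G dpsiE [LHS]mxE [X in _ + X]mxE.
    rewrite -derive_slice -dB.
    apply: (@deriveB _ _ _ (fun y => Phi (t, y)) (fun y => y *m B)).
      by apply: diff_derivable; exact: (smooth_differentiable x (sPhit t te')).
    apply: diff_derivable; apply: (smooth_differentiable (F := fun y : 'rV[R]_m => y *m B)).
    by move=> k; exact: smooth_on_mulmxr.
  have [s|a aE ->] := @MVT_sym R G (fun s => ki i (s, x) ord0 j) 0 t.
    rewrite !subr0 => st.
    apply: (@is_derive_comp_translation _ _ _ _ (fun p => 'D_(0, ei) Phi p ord0 j)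
      (fun s => (s, x)) _ _ (1, 0)).
      by move=> h; rewrite [RHS]/GRing.add/= /add_pair/= scaler0 add0r.
    apply: is_derive_entry; apply: diff_derivable.
    have [+ _] := smooth_derive (0, ei) sPhi 1%N; apply.
    by rewrite /D /=; lra.
  rewrite subr0 normrM ler_wpM2r//; apply: le_trans (normr_entry _ _ _) _.
  by apply: kM => //; move: aE; rewrite !subr0; lra.
apply: (@is_derive_quadratic _ _ _ (`|c| * (\sum_(i < m) \sum_(j < n) M ^+ 2)) (eps / 2)).
  by rewrite divr_gt0.
move=> t te; have te' : `|t| < eps by lra.
rewrite mulr0 subr0 !EH// ?normr0// Q0 addr0 -mulrBr addrAC subrr add0r.
rewrite normrM -mulrA ler_wpM2l//.
apply: cube_integral_norm_le; first exact/continuous_normsq_jac/sp.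
move=> u u01; rewrite ger0_norm; last first.
  by rewrite sumr_ge0// => i _; rewrite sumr_ge0// => j _; rewrite sqr_ge0.
rewrite mulr_suml; apply: ler_sum => i _; rewrite mulr_suml; apply: ler_sum => j _.
rewrite -real_normK ?num_real// -[t ^+ 2]real_normK ?num_real// -exprMn.
by rewrite lerXn2r ?nnegrE// ?mulr_ge0//; exact: dpsi.
Qed.

Lemma monodromy_affine X (XL : forall i, row i X \in L) :
  let f := @descend R m n A L (fun x => x *m (invmx A *m X)) in
  monodromy f X /\ is_lift f (fun x => x *m (invmx A *m X)).
Proof.
move=> f; have FX : equivariant A (fun x => x *m (invmx A *m X)) X.
  by move=> k x; rewrite mulmxDl -(row_mul k A) (mulmxA A) mulmxV// mul1mx.
have fF : is_lift f (fun x => x *m (invmx A *m X)).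
  by apply: descendE; exact: equivariantB_mem XL.
split=> //; exists (fun x => x *m (invmx A *m X)) => //.
exact: continuous_mulmxr.
Qed.

Lemma harmonic_classes_image (E : R) : harmonic_classes A L E =
  (fun X => [set g : T -> torus L | monodromy g X]) @`
    [set X : 'M[R]_(m, n) | tuples L X /\ torus_energy X = E].
Proof.
apply/seteqP; split=> [_ [f [hf Ef] <-]|_ [X [XL EX] <-]].
  have [F [sF fF]] := smooth_map_lift hf.1.
  have [X FX] := lift_equivariant Ld (smooth_continuous sF) fF.
  have fX : monodromy f X by exists F => //; exact: smooth_continuous.
  exists X; last exact/esym/(homotopy_class_monodromy Ld).
  split=> [i|]; first exact: monodromy_mem fX.
  by rewrite -(harmonic_energy hf fX).
have [fX fB] := monodromy_affine XL.
have hf := affine_harmonic fB.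
exists (@descend R m n A L (fun x => x *m (invmx A *m X))).
  by split=> //; rewrite (harmonic_energy hf fX).
exact: homotopy_class_monodromy.
Qed.

(** The class attached to [X] contains the linear map of [X], and uniqueness of its monodromy
    recovers [X] from the class. *)
Lemma card_harmonic_classes (E : R) :
  (harmonic_classes A L E #= [set X : 'M[R]_(m, n) | tuples L X /\ torus_energy X = E])%card.
Proof.
rewrite harmonic_classes_image; apply: inj_card_eq => X Y /set_mem[XL _] _ XY.
have [fX _] := monodromy_affine XL.
move/seteqP: XY => [/(_ _ fX) fY _].
by apply: (monodromy_inj Ld fX); exact: fY.
Qed.
End Harmonic.

(** * Exponential sums determine the number of values *)

Lemma ler_sum_uniq_sub (R : realType) (I : eqType) (s s' : seq I) (F : I -> R) :
    uniq s -> uniq s' -> {subset s <= s'} -> (forall x, 0 <= F x) ->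
  \sum_(x <- s) F x <= \sum_(x <- s') F x.
Proof.
move=> us us' ss' F0; rewrite [leRHS](bigID (mem s))/=.
have -> : \sum_(x <- s' | x \in s) F x = \sum_(x <- s) F x.
  rewrite -big_filter; apply: perm_big; apply: uniq_perm => //; first exact: filter_uniq.
  by move=> x; rewrite mem_filter; case: (boolP (x \in s)) => // /ss' ->.
by rewrite lerDl sumr_ge0.
Qed.

Lemma gap_above (R : realType) (s : seq R) (c : R) :
  exists2 e : R, 0 < e & forall y, y \in s -> c < y -> c + e <= y.
Proof.
elim: s => [|z s [e e0 es]]; first by exists 1.
have [zc|cz] := leP z c.
  exists e => // y; rewrite inE => /predU1P[->|]; last exact: es.
  by rewrite ltNge zc.
exists (Num.min e (z - c)); first by rewrite lt_min e0 subr_gt0.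
move=> y; rewrite inE => /predU1P[-> _|ys cy].
  by rewrite -lerBrDl ge_min lexx orbT.
apply: le_trans (es y ys cy); by rewrite lerD2l ge_min lexx.
Qed.

Lemma sum_const_seq (R : realType) (I : Type) (s : seq I) (c : R) :
  \sum_(x <- s) c = (size s)%:R * c.
Proof. by rewrite big_const_seq count_predT iter_addr_0 mulr_natl. Qed.

Section ExponentialSums.
Variable R : realType.

Definition expsum (I : Type) (q : I -> R) (t : R) (s : seq I) : R :=
  \sum_(x <- s) expR (- (t * q x)).

Definition expsum_bounded (I : eqType) (q : I -> R) := forall t, 0 < t ->
  exists M : R, forall s, uniq s -> expsum q t s <= M.

(** Comparison of the two total sums, expressed by finite sums and a tolerance so that no infinite
    sum has to be formed. *)
Definition expsum_dominated (I1 I2 : eqType) (q1 : I1 -> R) (q2 : I2 -> R) :=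
  forall t, 0 < t -> forall s1, uniq s1 -> forall e, 0 < e ->
    exists2 s2, uniq s2 & expsum q1 t s1 <= expsum q2 t s2 + e.

(** At [t = 1] each index of value at most [c] contributes at least [exp (- c)], so infinitely many
    of them would exceed any bound. *)
Lemma finite_sublevel (I : choiceType) (q : I -> R) (c : R) : expsum_bounded q ->
  finite_set [set x | q x <= c].
Proof.
move=> /(_ 1 ltr01)[M qM]; apply/finite_setPn => /card_leP[f].
have [k kM] : exists k : nat, M < k%:R * expR (- c).
  exists (Num.bound `|M / expR (- c)|); rewrite -ltr_pdivrMr ?expR_gt0//.
  exact: le_lt_trans (ler_norm _) (archi_boundP (normr_ge0 _)).
pose g i : I := val (f (to_setT i)).
pose s := [seq g i | i <- iota 0 k].
have us : uniq s.
  rewrite map_inj_uniq ?iota_uniq// => i j /val_inj fij.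
  have := @inj _ _ _ f (to_setT i) (to_setT j).
  by move=> /(_ (mem_set Logic.I) (mem_set Logic.I) fij) /(congr1 val).
have := qM s us; rewrite leNgt => /negP; apply; apply: lt_le_trans kM _.
rewrite /expsum big_map -[k in leLHS](size_iota 0) -sum_const_seq.
apply: ler_sum => i _; rewrite ler_expR lerN2 mul1r.
exact: set_mem (valP (f (to_setT i))).
Qed.

Variables (I : choiceType) (q : I -> R).
Hypothesis bq : expsum_bounded q.

Definition sublevel (c : R) : {fset I} := fset_set [set x | q x < c].
Definition level (c : R) : {fset I} := fset_set [set x | q x = c].

Lemma in_sublevel c x : (x \in sublevel c) = (q x < c).
Proof.
rewrite in_fset_set; last first.
  by apply: sub_finite_set (finite_sublevel c bq) => y /=; exact: ltW.
by apply/idP/idP => [/set_mem//|?]; exact/mem_set.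
Qed.

Lemma in_level c x : (x \in level c) = (q x == c).
Proof.
rewrite in_fset_set; last first.
  by apply: sub_finite_set (finite_sublevel c bq) => y /= ->.
by apply/idP/eqP => [/set_mem//|?]; exact/mem_set.
Qed.

(** With equal level counts below [c], this makes the lists of values below [c] of two families
    permutations of each other. *)
Lemma count_sublevel c y :
  count_mem y [seq q x | x <- sublevel c] = if y < c then #|` level y| else 0%N.
Proof.
rewrite count_map; have [yc|cy] := ltP y c.
  rewrite -size_filter; apply: perm_size; apply: uniq_perm.
  - by rewrite filter_uniq.
  - exact: fset_uniq.
  move=> x; rewrite mem_filter in_sublevel in_level /=.
  by case: eqP => // ->; rewrite yc.
apply/eqP; rewrite -leqn0 leqNgt -has_count; apply/hasPn => x; rewrite in_sublevel => qc /=.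
by rewrite lt_eqF// (lt_le_trans qc).
Qed.

(** For values beyond the gap, [t q = (t - 1) q + q >= (t - 1) (c + e) + q]; the tail is thus a
    decaying factor times a partial sum at time 1, whose bound does not depend on [t]. *)
Lemma expsum_split (t c e : R) (s : seq I) : 1 <= t -> uniq s ->
    (forall x, c < q x -> c + e <= q x) ->
  expsum q t s <= expsum q t (sublevel c) + #|` level c|%:R * expR (- (t * c))
    + expR (- ((t - 1) * (c + e))) * expsum q 1 s.
Proof.
move=> t1 us ce; rewrite {1}/expsum (bigID (fun x => q x < c))/= -addrA lerD//.
  rewrite -big_filter; apply: ler_sum_uniq_sub.
  - exact: filter_uniq.
  - exact: fset_uniq.
  - by move=> x; rewrite mem_filter in_sublevel => /andP[].
  - by move=> x; exact: expR_ge0.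
rewrite (bigID (fun x => q x == c))/= lerD//.
  rewrite -big_filter.
  apply: (@le_trans _ _ (\sum_(x <- level c) expR (- (t * q x)))).
    apply: ler_sum_uniq_sub.
    - exact: filter_uniq.
    - exact: fset_uniq.
    - by move=> x; rewrite mem_filter in_level => /andP[/andP[_ ->]].
    - by move=> x; exact: expR_ge0.
  rewrite big_seq (eq_bigr (fun=> expR (- (t * c)))); last first.
    by move=> x; rewrite in_level => /eqP ->.
  by rewrite -big_seq sum_const_seq.
rewrite /expsum mulr_sumr [leRHS](bigID (fun x => ~~ (q x < c) && (q x != c)))/=.
rewrite -[leLHS]addr0 lerD//; last first.
  by apply: sumr_ge0 => x _; rewrite mulr_ge0 ?expR_ge0.
apply: ler_sum => x /andP[]; rewrite -leNgt => cq qc.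
rewrite -expRD ler_expR.
have /ce qx : c < q x by rewrite lt_neqAle eq_sym qc.
nra.
Qed.
End ExponentialSums.

Section LevelCounts.
Variable R : realType.

(* Cancel the equal contributions of the values below [c], multiply by [exp (t c)]
   and let [t] grow. *)
Lemma card_level_le (I1 I2 : choiceType) (q1 : I1 -> R) (q2 : I2 -> R) (c : R) :
    expsum_bounded q1 -> expsum_bounded q2 -> expsum_dominated q1 q2 ->
    (forall y, y < c -> #|` level q1 y| = #|` level q2 y|) ->
  (#|` level q1 c| <= #|` level q2 c|)%N.
Proof.
move=> b1 b2 dom eqlt.
have lowE t : expsum q1 t (sublevel q1 c) = expsum q2 t (sublevel q2 c).
  have seqE (I : choiceType) (q : I -> R) : expsum q t (sublevel q c) =
      \sum_(y <- [seq q x | x <- sublevel q c]) expR (- (t * y)).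
    by rewrite big_map.
  rewrite !seqE; apply: perm_big; apply/allP => y _ /=.
  by rewrite !count_sublevel//; case: ifP => // /eqlt ->.
(* Finitely many indices have value below [c + 1], so [gap_above] handles the values in between and
   1 handles the others. *)
have [e e0 gap] : exists2 e : R, 0 < e & forall x, c < q2 x -> c + e <= q2 x.
  have [e e0 es] := gap_above [seq q2 x | x <- sublevel q2 (c + 1)] c.
  exists (Num.min e 1); first by rewrite lt_min e0 ltr01.
  move=> x cx; have [xc|xc] := ltP (q2 x) (c + 1).
    apply: le_trans (es _ _ cx); first by rewrite lerD2l ge_min lexx.
    by apply: map_f; rewrite in_sublevel.
  by apply: le_trans xc; rewrite lerD2l ge_min lexx orbT.
have [M qM] := b2 1 ltr01.
have M0 : 0 <= M by apply: le_trans (qM [::] isT); rewrite /expsum big_nil.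
pose K := M * expR (c + e).
have K0 : 0 <= K by rewrite mulr_ge0 ?expR_ge0.
(* [K * exp (- t e)] will bound the tail relative to [exp (- t c)]. Since [1 + t e <= exp (t e)], it
   is enough that [2 K < 1 + t e]. *)
have [t t1 tK] : exists2 t, 1 <= t & K * expR (- (t * e)) < 1 / 2.
  exists (1 + 2 * K / e); first by rewrite lerDl !mulr_ge0 ?invr_ge0 ?(ltW e0).
  set t := 1 + _; rewrite expRN ltr_pdivrMr ?expR_gt0//.
  apply: (@lt_le_trans _ _ (1 / 2 * (1 + t * e))); last by rewrite ler_wpM2l// expR_ge1Dx.
  rewrite /t mulrDl mul1r divfK ?gt_eqF//; lra.
have t0 : 0 < t by lra.
pose s1 := (sublevel q1 c : seq I1) ++ level q1 c.
have us1 : uniq s1.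
  rewrite cat_uniq !fset_uniq /= andbT; apply/hasPn => x.
  by rewrite in_level// in_sublevel// => /eqP ->; rewrite ltxx.
(* Half of [exp (- t c)] is the tolerance in the domination and the tail stays below the other half:
   the total error is less than one term of value [c], so the counts compare as integers. *)
have ec0 : 0 < expR (- (t * c)) / 2 by rewrite divr_gt0 ?expR_gt0.
have [s2 us2 s12] := dom t t0 s1 us1 _ ec0.
have := le_trans s12 (lerD (expsum_split b2 t1 us2 gap) (lexx _)).
rewrite {1}/expsum big_cat/= -/(expsum q1 t (sublevel q1 c)) lowE.
rewrite -!addrA lerD2l big_seq (eq_bigr (fun=> expR (- (t * c)))); last first.
  by move=> x; rewrite in_level// => /eqP ->.
rewrite -big_seq sum_const_seq => le12.
have tail : expR (- ((t - 1) * (c + e))) * expsum q2 1 s2 < 1 / 2 * expR (- (t * c)).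
  have -> : - ((t - 1) * (c + e)) = (c + e) + (- (t * e) + - (t * c)) by ring.
  rewrite expRD (expRD (- (t * e))).
  set a := expR (c + e); set x := expR (- (t * e)); set y := expR (- (t * c)).
  set S := expsum _ _ _; have -> : a * (x * y) * S = S * a * x * y by ring.
  rewrite ltr_pM2r ?expR_gt0//; apply: le_lt_trans tK.
  by rewrite /K !ler_wpM2r ?expR_ge0// /S qM.
suff : #|` level q1 c|%:R * expR (- (t * c)) < (#|` level q2 c|.+1)%:R * expR (- (t * c)).
  by rewrite ltr_pM2r ?expR_gt0// ltr_nat ltnS.
rewrite -natr1 mulrDl mul1r; lra.
Qed.

(** Real levels are not well ordered, but finitely many indices lie below [c], and the induction is
    on their number in both families. Passing to [y < c] lowers it if either level at [y] is
    inhabited; otherwise both are empty. *)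
Theorem card_level_eq (I1 I2 : choiceType) (q1 : I1 -> R) (q2 : I2 -> R) :
    expsum_bounded q1 -> expsum_bounded q2 ->
    expsum_dominated q1 q2 -> expsum_dominated q2 q1 ->
  forall c, #|` level q1 c| = #|` level q2 c|.
Proof.
move=> b1 b2 d12 d21 c.
have [k] := ubnP (#|` sublevel q1 c| + #|` sublevel q2 c|)%N.
elim: k c => // k IH c; rewrite ltnS => ck.
have eqlt y : y < c -> #|` level q1 y| = #|` level q2 y|.
  move=> yc; have sub (I : choiceType) (q : I -> R) (bq : expsum_bounded q) :
      (sublevel q y `<=` sublevel q c)%fset.
    by apply/fsubsetP => x; rewrite !in_sublevel// => /lt_trans; apply.
  have ltn (I : choiceType) (q : I -> R) (bq : expsum_bounded q) x : x \in level q y ->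
      (#|` sublevel q y| < #|` sublevel q c|)%N.
    rewrite in_level// => /eqP qx; apply: fproper_ltn_card.
    rewrite fproperE sub//=; apply/fsubsetPn.
    by exists x; rewrite in_sublevel// qx ?ltxx.
  have [E1|[x1 x1y]] := fset_0Vmem (level q1 y); last first.
    apply: IH; apply: leq_trans ck; rewrite -addSn leq_add ?(ltn _ _ _ x1)//.
    exact/fsubset_leq_card/sub.
  have [E2|[x2 x2y]] := fset_0Vmem (level q2 y); last first.
    apply: IH; apply: leq_trans ck; rewrite -addnS leq_add ?(ltn _ _ _ x2)//.
    exact/fsubset_leq_card/sub.
  by rewrite E1 E2.
apply/eqP; rewrite eqn_leq !card_level_le// => y yc; exact/esym/eqlt.
Qed.

Lemma card_eq_level (I1 I2 : choiceType) (q1 : I1 -> R) (q2 : I2 -> R) (c : R) :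
    expsum_bounded q1 -> expsum_bounded q2 -> #|` level q1 c| = #|` level q2 c| ->
  ([set x | q1 x = c] #= [set x | q2 x = c])%card.
Proof.
move=> b1 b2 cardE; apply/fcard_eq => //.
  by apply: sub_finite_set (finite_sublevel c b1) => y /= ->.
by apply: sub_finite_set (finite_sublevel c b2) => y /= ->.
Qed.
End LevelCounts.

(** * Theta series *)

Section SumsOverIntegerMatrices.
Variable R : realType.

Lemma sum_geometric_le (r : R) N : 0 <= r -> r < 1 -> \sum_(k < N) r ^+ k <= (1 - r)^-1.
Proof.
move=> r0 r1; have r10 : 0 < 1 - r by rewrite subr_gt0.
rewrite -[leRHS]mul1r ler_pdivlMr// mulrC -[1 - r]opprB mulNr -subrX1 opprB.
by rewrite gerBl exprn_ge0.
Qed.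

(** Recording each entry by a sign and a bounded absolute value embeds [s] in a finite function
    space, over which the sum of products factors into [d * n] equal sums. Each is at most twice a
    geometric series, the 2 counting signs. *)
Lemma sum_prod_absz_le d n (r : R) (s : seq 'M[int]_(d, n)) : 0 <= r -> r < 1 -> uniq s ->
  \sum_(z <- s) \prod_(p : 'I_d * 'I_n) r ^+ `|z p.1 p.2|%N <= (2 / (1 - r)) ^+ (d * n).
Proof.
move=> r0 r1 us.
pose N := (\max_(z <- s) \max_(p : 'I_d * 'I_n) `|z p.1 p.2|)%N.
have zN z p : z \in s -> (`|z p.1 p.2| < N.+1)%N.
  move=> zs; rewrite ltnS; apply: (leq_trans _ (leq_bigmax_seq _ zs isT)).
  exact: (leq_bigmax p).
pose phi (z : 'M[int]_(d, n)) : {ffun 'I_d * 'I_n -> bool * 'I_N.+1} :=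
  [ffun p => (z p.1 p.2 < 0, inord `|z p.1 p.2|%N)].
pose W (f : {ffun 'I_d * 'I_n -> bool * 'I_N.+1}) := \prod_p r ^+ (f p).2.
have phi_inj : {in s &, injective phi}.
  move=> z z' zs z's /ffunP zz'; apply/matrixP => i j.
  have := zz' (i, j); rewrite !ffunE /= => -[sgn /(congr1 val)].
  rewrite /= !inordK ?zN//; first by lia.
  - exact: (zN _ (i, j)).
  - exact: (zN _ (i, j)).
have -> : \sum_(z <- s) \prod_p r ^+ `|z p.1 p.2|%N = \sum_(f <- map phi s) W f.
  rewrite big_map big_seq [RHS]big_seq; apply: eq_bigr => z zs.
  by apply: eq_bigr => p _; rewrite ffunE /= inordK ?zN.
apply: (@le_trans _ _ (\sum_f W f)).
  apply: ler_sum_uniq_sub.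
  - by rewrite map_inj_in_uniq.
  - exact: index_enum_uniq.
  - by move=> f _; exact: mem_index_enum.
  - by move=> f; apply: prodr_ge0 => p _; exact: exprn_ge0.
rewrite /W -(bigA_distr_bigA (fun (p : 'I_d * 'I_n) (k : bool * 'I_N.+1) => r ^+ k.2)) /=.
rewrite prodr_const card_prod !card_ord; apply: lerXn2r; rewrite ?nnegrE.
- by apply: sumr_ge0 => k _; exact: exprn_ge0.
- by rewrite divr_ge0// subr_ge0 ltW.
rewrite -(pair_bigA _ (fun _ (k : 'I_N.+1) => r ^+ k)) /= sumr_const card_bool -[leLHS]mulr_natl.
by rewrite ler_wpM2l// sum_geometric_le.
Qed.
End SumsOverIntegerMatrices.

(** * Lattices contained in (1/2) Z^n: discreteness and summability *)

Section HalfIntegral.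
Variable R : realType.

Definition half_integral n (L : zmodClosed 'rV[R]_n) :=
  forall v, v \in L -> exists z : 'rV[int]_n, 2 *: v = map_mx intr z.

(** Doubling a vector shorter than 1/2 gives integer entries of absolute value below 1. *)
Lemma half_integral_discrete n (L : zmodClosed 'rV[R]_n) :
  half_integral L -> discrete_lattice L.
Proof.
move=> hL; exists (1 / 2) => // v vL v2.
have [z vz] := hL v vL.
apply/rowP => j; rewrite mxE; have /(congr1 (fun M : 'rV[R]_n => M ord0 j)) := vz.
rewrite !mxE => vj.
have : `|(z ord0 j)%:~R| < 1 :> R.
  rewrite -vj normrM gtr0_norm//.
  by apply: (@le_lt_trans _ _ (2 * `|v|)); [rewrite ler_wpM2l// normr_entry|lra].
rewrite -intr_norm -[1]/(1%:~R) ltr_int => zj.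
have z0 : z ord0 j = 0 by lia.
by move: vj; rewrite z0 => /eqP; rewrite mulf_eq0 pnatr_eq0 /= => /eqP.
Qed.

Lemma half_integral_Gamma n : half_integral (Gamma R n).
Proof.
apply: zspan_ind.
- by exists 0; rewrite scaler0 map_mx0.
- by move=> u v [z uz] [w vw]; exists (z - w); rewrite scalerBr uz vw map_mxB.
- move=> _ [[z _ <-]|->].
    by exists (2 *: z); apply/rowP => j; rewrite !mxE rmorphM.
  by exists (const_mx 1); apply/rowP => j; rewrite !mxE divff ?pnatr_eq0.
Qed.

Lemma half_integral_Gamma88 : half_integral (Gamma88 R).
Proof.
move=> v /andP[/half_integral_Gamma[z vz] /half_integral_Gamma[w vw]].
exists (row_mx z w); rewrite map_row_mx -vz -vw -scale_row_mx.
by rewrite hsubmxK.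
Qed.

Lemma half_integral_tuples d n (L : zmodClosed 'rV[R]_n) (X : 'M[R]_(d, n)) :
  half_integral L -> tuples L X -> exists z : 'M[int]_(d, n), 2 *: X = map_mx intr z.
Proof.
move=> hL LX; pose z i := sval (cid (hL _ (LX i))).
exists (\matrix_i z i); apply/row_matrixP => i.
rewrite linearZ /= (svalP (cid (hL _ (LX i)))).
by apply/rowP => j; rewrite !mxE.
Qed.

Definition lattice_norm d n (A : 'M[R]_d) (L : zmodClosed 'rV[R]_n)
  (x : set_type (@tuples R d n L)) : R := \sum_i \sum_j (invmx A *m val x) i j ^+ 2.

(** From [X = A (A^-1 X)], each entry of [X] is at most [a] times the Euclidean norm of [A^-1 X].
    Summing [d * n] squares gives [K], where 1 is added for positivity. *)
Lemma norm_invmx_lower d n (A : 'M[R]_d) : A \in unitmx ->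
  exists2 c : R, 0 < c & forall X : 'M[R]_(d, n),
    c * (\sum_i \sum_j X i j ^+ 2) <= \sum_i \sum_j (invmx A *m X) i j ^+ 2.
Proof.
move=> Au; pose a := \sum_i \sum_j `|A i j|; pose K := (d * n)%:R * a ^+ 2 + 1.
have a0 : 0 <= a by apply: sumr_ge0 => i _; apply: sumr_ge0.
have K0 : 0 < K by rewrite ltr_wpDl// mulr_ge0// sqr_ge0.
exists K^-1; first by rewrite invr_gt0.
move=> X; set Y := invmx A *m X; set q := leRHS.
have XE : X = A *m Y by rewrite mulmxA mulmxV// mul1mx.
have sq_le m (F : 'I_m -> R) i : (forall i, 0 <= F i) -> F i <= \sum_k F k.
  by move=> F0; rewrite (bigD1 i)//= lerDl sumr_ge0.
have q0 : 0 <= q by apply: sumr_ge0 => i _; apply: sumr_ge0 => j _; exact: sqr_ge0.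
have Yq k j : `|Y k j| <= Num.sqrt q.
  rewrite -sqrtr_sqr ler_wsqrtr//; apply: le_trans (sq_le _ (fun j => Y k j ^+ 2) j _) _.
    by move=> ?; exact: sqr_ge0.
  apply: (sq_le _ (fun k => \sum_j Y k j ^+ 2) k) => i.
  by apply: sumr_ge0 => ? _; exact: sqr_ge0.
have Xq i j : X i j ^+ 2 <= a ^+ 2 * q.
  rewrite -real_normK ?num_real// -[in leRHS](sqr_sqrtr q0) -exprMn.
  rewrite lerXn2r ?nnegrE// ?mulr_ge0 ?sqrtr_ge0//.
  rewrite XE mxE; apply: le_trans (ler_norm_sum _ _ _) _.
  apply: (@le_trans _ _ (\sum_k `|A i k| * Num.sqrt q)).
    by apply: ler_sum => k _; rewrite normrM ler_wpM2l.
  rewrite -mulr_suml ler_wpM2r ?sqrtr_ge0//.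
  by apply: (sq_le _ (fun i => \sum_k `|A i k|) i) => ?; apply: sumr_ge0.
rewrite ler_pdivrMl//.
apply: (@le_trans _ _ (\sum_(i < d) \sum_(j < n) (a ^+ 2 * q))).
  by apply: ler_sum => i _; apply: ler_sum => j _.
rewrite !sumr_const !card_ord -mulrnA mulnC -mulr_natl mulrA /K mulrDl lerDl; lra.
Qed.

(** Doubling a tuple gives an integer matrix [zeta], whence the 4 in [b]. As [|k| <= k ^+ 2] for
    integers, the Gaussian terms are below products of powers of [r = exp (- b)], which
    [sum_prod_absz_le] sums. *)
Lemma lattice_norm_bounded d n (A : 'M[R]_d) (L : zmodClosed 'rV[R]_n) :
  A \in unitmx -> half_integral L -> expsum_bounded (@lattice_norm d n A L).
Proof.
move=> Au hL t t0.
have [c c0 cq] := norm_invmx_lower n Au.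
pose zeta (x : set_type (@tuples R d n L)) : 'M[int]_(d, n) :=
  sval (cid (half_integral_tuples hL (set_mem (valP x)))).
have zetaP x : 2 *: val x = map_mx intr (zeta x).
  exact: svalP (cid (half_integral_tuples hL (set_mem (valP x)))).
have zeta_inj : injective zeta.
  move=> x y xy; apply: val_inj; have := zetaP x; rewrite xy -zetaP.
  by apply: scalerI; rewrite pnatr_eq0.
pose b := t * c / 4; pose r := expR (- b).
have b0 : 0 < b by rewrite /b divr_gt0// mulr_gt0.
exists ((2 / (1 - r)) ^+ (d * n)) => s us.
have r1 : r < 1 by rewrite expR_lt1 oppr_lt0.
apply: le_trans (sum_prod_absz_le (expR_ge0 _) r1 (_ : uniq (map zeta s))); last first.
  by rewrite map_inj_uniq.
rewrite big_map; apply: ler_sum => x _.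
have -> : \prod_(p : 'I_d * 'I_n) r ^+ `|zeta x p.1 p.2|%N =
    expR (- (b * \sum_i \sum_j (`|zeta x i j|%N)%:R)).
  rewrite pair_bigA /= mulr_sumr -sumrN expR_sum; apply: eq_bigr => p _.
  by rewrite /r -expRM_natl mulrN mulrC.
rewrite ler_expR lerN2 /b -!mulrA ler_wpM2l ?(ltW t0)//.
apply: le_trans (cq (val x)); rewrite ler_wpM2l ?(ltW c0)//.
rewrite ler_pdivrMl// mulr_sumr; apply: ler_sum => i _.
rewrite mulr_sumr; apply: ler_sum => j _.
have /(congr1 (fun M : 'M[R]_(d, n) => M i j)) := zetaP x; rewrite !mxE => xE.
have -> : 4 * (val x) i j ^+ 2 = (2 * (val x) i j) ^+ 2 by ring.
rewrite xE -[X in _ <= X ^+ 2]/((zeta x i j)%:~R) natr_absz -rmorphXn /= ler_int.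
by nia.
Qed.
End HalfIntegral.

Section RealSums.
Variables (R : realType) (I : choiceType) (g : I -> R).
Hypothesis g0 : forall x, 0 <= g x.

(** With nonnegative terms, finite sums increase along the directed set of finite subsets and so
    converge to their supremum [S]. The first two clauses describe [S] by sums over sequences, the
    language of [expsum]. *)
Lemma summability_sum_real (M : R) :
    (forall s : seq I, uniq s -> \sum_(x <- s) g x <= M) ->
  exists S : R, [/\ forall s : seq I, uniq s -> \sum_(x <- s) g x <= S,
    forall e, 0 < e -> exists2 s : seq I, uniq s & S <= \sum_(x <- s) g x + e &
    summability.sum (fun x => (g x)%:C : (R[i])^o) = S%:C].
Proof.
move=> gM.
pose P := [set y | exists J : {fset I}, y = \sum_(x <- J) g x].
have supP : has_sup P.
  split; first by exists (\sum_(x <- fset0) g x); exists fset0.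
  by exists M => _ [J ->]; apply: gM; exact: fset_uniq.
have leS s : uniq s -> \sum_(x <- s) g x <= sup P.
  move=> us; apply: (@le_trans _ _ (\sum_(x <- [fset x in s]%fset) g x)).
    by apply: ler_sum_uniq_sub => // x; rewrite !inE.
  by apply: ub_le_sup; [exact: supP.2|exists [fset x in s]%fset].
have near_S e : 0 < e -> exists2 J : {fset I}, True & sup P <= \sum_(x <- J) g x + e.
  move=> e0; have [_ [J ->] SJ] := sup_adherent e0 supP.
  by exists J => //; rewrite -lerBlDr ltW.
exists (sup P); split=> //.
  by move=> e /near_S[J _ SJ]; exists J => //; exact: fset_uniq.
have PF : ProperFilter (@summability.totally I) := summability.totally_filter.
apply: cvg_lim; first exact: norm_hausdorff.
(* A positive element of [R[i]] has zero imaginary part, so its real part serves as the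
   tolerance. *)
apply/cvgrPdist_le => e; rewrite ltcE /= => /andP[/eqP Ime Ree].
have [J _ SJ] := near_S _ Ree.
exists J => // K /= JK.
rewrite /summability.partial_sum -(big_seq_fsetE _ K xpredT (fun x => (g x)%:C))/=.
rewrite -rmorph_sum -rmorphB /= normc_def /= expr0n /= addr0 sqrtr_sqr.
rewrite lecE /= Ime eqxx /= ger0_norm ?subr_ge0 ?leS//.
rewrite lerBlDr; apply: le_trans SJ _; rewrite addrC lerD2l.
by apply: ler_sum_uniq_sub => //; exact/fsubsetP.
Qed.
End RealSums.

Section ThetaSeries.
Variables (R : realType) (d : nat) (A : 'M[R]_d).

(* [i (t / pi) (A A^T)^-1], at which the theta series is [\sum_x exp (- t |A^-1 x|^2)]. *)
Definition theta_arg (t : R) : 'M[R[i]]_d :=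
  map_mx (real_complex R) 0 + 'i%C *:
    map_mx (real_complex R) ((t / pi) *: ((invmx A)^T *m invmx A)).

Lemma siegel_theta_arg t : A \in unitmx -> 0 < t -> siegel (theta_arg t).
Proof.
move=> Au t0; exists 0, ((t / pi) *: ((invmx A)^T *m invmx A)); split=> //.
- by rewrite trmx0.
- by rewrite linearZ /= trmx_mul trmxK.
move=> v v0; rewrite -scalemxAr -scalemxAl mxE mulr_gt0//.
  by rewrite divr_gt0// pi_gt0.
rewrite mulmxA -(mulmxA (v *m (invmx A)^T)); set w := v *m _.
have -> : invmx A *m v^T = w^T by rewrite trmx_mul trmxK.
have w0 : w != 0.
  apply: contra_neq v0 => w0.
  have AT : (invmx A)^T \in unitmx by rewrite unitmx_tr unitmx_inv.
  by rewrite -[v](mulmxK AT) -/w w0 mul0mx.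
rewrite mxE; under eq_bigr do rewrite [X in _ * X]mxE -expr2.
rewrite lt_def sumr_ge0 ?andbT; last by move=> i _; exact: sqr_ge0.
apply: contra_neq w0 => /eqP; rewrite psumr_eq0; last by move=> i _; exact: sqr_ge0.
move=> /allP w0; apply/rowP => i; rewrite [RHS]mxE.
by have := w0 i (mem_index_enum _); rewrite /= sqrf_eq0 => /eqP.
Qed.

Lemma cexp_real (a : R) : cexp a%:C = (expR a)%:C.
Proof. by rewrite /cexp /= cos0 sin0 mulr1. Qed.

Lemma mxtrace_gram n (X : 'M[R]_(d, n)) :
  \tr (X *m X^T *m ((invmx A)^T *m invmx A)) = \sum_i \sum_j (invmx A *m X) i j ^+ 2.
Proof.
rewrite mulmxA mxtrace_mulC !mulmxA.
have -> : invmx A *m X *m X^T *m (invmx A)^T = (invmx A *m X) *m (invmx A *m X)^T.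
  by rewrite trmx_mul !mulmxA.
apply: eq_bigr => i _; rewrite mxE; apply: eq_bigr => j _.
by rewrite [_^T _ _]mxE expr2.
Qed.

Lemma theta_expsum n (L : zmodClosed 'rV[R]_n) t : theta L (theta_arg t) =
  summability.sum (fun x : set_type (@tuples R d n L) =>
    (expR (- (t * lattice_norm A x)))%:C : (R[i])^o).
Proof.
have eq_sum (f g : set_type (@tuples R d n L) -> (R[i])^o) : f =1 g ->
    summability.sum f = summability.sum g by move=> /funext ->.
apply: eq_sum => x /=.
rewrite -cexp_real; congr cexp.
rewrite /theta_arg map_mx0 add0r -scalemxAr -map_mxM linearZ /= trace_map_mx.
rewrite -scalemxAr linearZ /= mxtrace_gram -/(lattice_norm A x).
(* The two factors [i] produce the sign and [pi] cancels against [t / pi], which leaves a real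
   exponent. *)
rewrite mulrA -[_ * 'i%C * 'i%C]mulrA -expr2 sqr_i mulrN1 mulNr -rmorphM -rmorphN /=.
by congr (_%:C); rewrite mulrA mulrCA divff ?mulr1// gt_eqF// pi_gt0.
Qed.
End ThetaSeries.

(** A finite sum on one side is below the common value of the theta series, and finite sums on the
    other side come within [e] of it. *)
Lemma theta_dominated (R : realType) d n1 n2 (A : 'M[R]_d)
    (L1 : zmodClosed 'rV[R]_n1) (L2 : zmodClosed 'rV[R]_n2) : A \in unitmx ->
    half_integral L1 -> half_integral L2 ->
    (forall Z : 'M[R[i]]_d, siegel Z -> theta L1 Z = theta L2 Z) ->
  expsum_dominated (@lattice_norm R d n1 A L1) (@lattice_norm R d n2 A L2).
Proof.
move=> Au h1 h2 htheta t t0 s1 us1 e e0.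
have [M1 b1] := lattice_norm_bounded Au h1 t0.
have [M2 b2] := lattice_norm_bounded Au h2 t0.
have [S1 [S1ub _ S1E]] := summability_sum_real (fun x => expR_ge0 _) b1.
have [S2 [_ S2near S2E]] := summability_sum_real (fun x => expR_ge0 _) b2.
have := htheta _ (siegel_theta_arg Au t0); rewrite !theta_expsum S1E S2E => -[S12].
have [s2 us2 S2s] := S2near e e0; exists s2 => //.
by apply: le_trans (S1ub s1 us1) _; rewrite S12.
Qed.

Theorem card_tuples_energy (R : realType) d n1 n2 (A : 'M[R]_d)
    (L1 : zmodClosed 'rV[R]_n1) (L2 : zmodClosed 'rV[R]_n2) (E : R) : A \in unitmx ->
    half_integral L1 -> half_integral L2 ->
    (forall Z : 'M[R[i]]_d, siegel Z -> theta L1 Z = theta L2 Z) ->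
  ([set X : 'M[R]_(d, n1) | tuples L1 X /\ torus_energy A X = E] #=
   [set X : 'M[R]_(d, n2) | tuples L2 X /\ torus_energy A X = E])%card.
Proof.
move=> Au h1 h2 htheta.
(* The value of [|A^-1 X|^2] that corresponds to the energy [E]. *)
pose E' := 2 * E / `|\det A|.
have detA0 : `|\det A| != 0 by rewrite normr_eq0 -unitfE -unitmxE.
have image_level n (L : zmodClosed 'rV[R]_n) :
    [set X : 'M[R]_(d, n) | tuples L X /\ torus_energy A X = E] =
    val @` [set x : set_type (@tuples R d n L) | lattice_norm A x = E'].
  apply/seteqP; split=> [X [LX EX]|_ [x xE <-]].
    exists (SigSub (mem_set LX)) => //=.
    by rewrite /lattice_norm /E' -EX /torus_energy /=; field; rewrite detA0.
  split; first exact: set_mem (valP x).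
  have -> : torus_energy A (val x) = 2^-1 * (`|\det A| * lattice_norm A x) by [].
  by rewrite xE /E'; field; rewrite detA0.
have val_card n (L : zmodClosed 'rV[R]_n) :
    ([set X : 'M[R]_(d, n) | tuples L X /\ torus_energy A X = E] #=
     [set x : set_type (@tuples R d n L) | lattice_norm A x = E'])%card.
  by rewrite image_level; apply: inj_card_eq => x y _ _; exact: val_inj.
rewrite (card_eql (val_card _ L1)) (card_eqr (val_card _ L2)).
have b1 := lattice_norm_bounded Au h1; have b2 := lattice_norm_bounded Au h2.
apply: card_eq_level => //; apply: card_level_eq => //.
  exact: theta_dominated.
by apply: theta_dominated => // Z sZ; rewrite htheta.
Qed.

Theorem proposition1p4 (R : realType) (d : nat) (hd : (1 <= d)%N)
    (htheta : forall Z : 'M[R[i]]_d, siegel Z ->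
       theta (Gamma88 R) Z = theta (Gamma R 16) Z)
    (A : 'M[R]_d) (hA : A \in unitmx) (E : R) (hE : 0 <= E) :
  (harmonic_classes A (Gamma88 R) E #= harmonic_classes A (Gamma R 16) E)%card.
Proof.
have h88 := @half_integral_Gamma88 R; have h16 := @half_integral_Gamma R 16.
rewrite (card_eql (card_harmonic_classes (half_integral_discrete h88) hA E)).
rewrite (card_eqr (card_harmonic_classes (half_integral_discrete h16) hA E)).
exact: card_tuples_energy.
Qed.
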